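(* For any $\mathrm{D}$-free skew shape $S$ and any $k\ge 1$, we have $\mathrm{Tr}(S,\delta_k)=\mathrm{Tr}(S,\iota_k)$.
   Context: A cell is a unit square with vertices in $\mathbb{Z}^2$; its coordinates are those of its top-right corner, so cell $(i,j)$ is the cell in column $i$ and row $j$ (columns numbered left to right, rows numbered bottom to top). A shape is a finite union of cells; shapes are considered up to translation and, unless stated otherwise, a nonempty shape is placed so that its leftmost cell has column coordinate $1$ and its bottommost cell has row coordinate $1$. The height (width) of a shape is the row coordinate of its topmost cell (the column coordinate of its rightmost cell). A NW Ferrers shape is a top-left justified Young-diagram shape: every row is a contiguous run of cells, every column is a contiguous run of cells, all rows have their leftmost cell in the same column, and all columns have their topmost cell in the same row. A skew shape is a shape of the form $S=F_1\setminus F_2$ (the cells of $F_1$ not belonging to $F_2$), where $F_1$ and $F_2$ are NW Ferrers shapes with the same top-left cell ($F_2$ may be empty). Containment of shapes: a shape $S$ of height $h$ and width $w$ contains a shape $T$ of height $k$ and width $\ell$ if there are row indices $1\le r_1<\dots<r_k\le h$ and column indices $1\le c_1<\dots<c_\ell\le w$ such that for all $1\le i\le \ell$, $1\le j\le k$, the cell $(i,j)$ belongs to $T$ if and only if the cell $(c_i,r_j)$ belongs to $S$. Such rows and columns form an occurrence of $T$ in $S$. Otherwise $S$ avoids $T$. $\mathrm{D}$ is the skew shape obtained from the $3\times3$ square $\{(i,j):1\le i,j\le 3\}$ by removing the top-left cell $(1,3)$ and the bottom-right cell $(3,1)$ (so it has 7 cells). A skew shape is $\mathrm{D}$-free if it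 avoids $\mathrm{D}$. A binary filling of a shape assigns a value in $\{0,1\}$ to each cell; a 1-cell is a cell with value $1$. A binary filling of $S$ is a transversal filling if every row and every column of $S$ has exactly one 1-cell. A filling $\phi_S$ of $S$ contains a filling $\phi_T$ of $T$ if there is an occurrence of $T$ in $S$, in rows $r_1<\dots<r_k$ and columns $c_1<\dots<c_\ell$, such that $\phi_T(i,j)\le\phi_S(c_i,r_j)$ for every cell $(i,j)$ of $T$; otherwise $\phi_S$ avoids $\phi_T$. For $k\ge1$, $\iota_k$ is the filling of the $k\times k$ square shape with 1-cells $(i,i)$, $1\le i\le k$, and $\delta_k$ is the filling of the $k\times k$ square shape with 1-cells $(i,k+1-i)$, $1\le i\le k$ (other cells have value $0$). $\mathrm{Tr}(S,\pi)$ denotes the number of transversal fillings of $S$ that avoid the filling $\pi$. *)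

(* Defs.v *)
From HB Require Import structures.
From mathcomp Require Import all_boot finmap.

Set Implicit Arguments.
Unset Strict Implicit.
Unset Printing Implicit Defensive.

Local Open Scope fset_scope.
Local Open Scope nat_scope.

(* (i, j) is the cell in column i (left to right) and row j (bottom to top).
   Since shapes matter only up to translation, natural number coordinates
   suffice. *)
Notation cell := (nat * nat)%type.
Notation cell_shape := {fset cell}.

(* The normal position: leftmost column 1 and bottommost row 1; the empty
   shape is placed by convention. *)
Definition placed (S : cell_shape) : Prop :=
  (forall p, p \in S -> 1 <= p.1 /\ 1 <= p.2) /\
  (S <> fset0 ->
     (exists j, (1, j) \in S) /\ (exists i, (i, 1) \in S)).

(* For a placed shape; both are 0 for the empty shape. *)
Definition width (S : cell_shape) : nat := \max_(p <- S) p.1.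
Definition height (S : cell_shape) : nat := \max_(p <- S) p.2.

Definition translate (a b : nat) (S : cell_shape) : cell_shape :=
  [fset ((p.1 + a, p.2 + b) : cell) | p in S].

Definition row_contiguous (F : cell_shape) : Prop :=
  forall i1 i2 i3 j, i1 <= i2 <= i3 ->
    (i1, j) \in F -> (i3, j) \in F -> (i2, j) \in F.

Definition col_contiguous (F : cell_shape) : Prop :=
  forall i j1 j2 j3, j1 <= j2 <= j3 ->
    (i, j1) \in F -> (i, j3) \in F -> (i, j2) \in F.

(* NW Ferrers shape with top-left cell (a, b): the leftmost cell of every
   nonempty row is in column a, and the topmost cell of every nonempty column
   is in row b.  The empty shape satisfies this for all a and b. *)
Definition NW_Ferrers (a b : nat) (F : cell_shape) : Prop :=
  [/\ row_contiguous F, col_contiguous F,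
      forall i j, (i, j) \in F -> (a, j) \in F /\ a <= i
    & forall i j, (i, j) \in F -> (i, b) \in F /\ j <= b].

(* F1 `\` F2 need not be placed when F1 is, as F2 may cover whole rows or
   columns of F1, whence the translation. *)
Definition skew_shape (S : cell_shape) : Prop :=
  exists (s t a b : nat) (F1 F2 : cell_shape),
    [/\ NW_Ferrers a b F1, NW_Ferrers a b F2 & translate s t S = F1 `\` F2].

Definition increasing m n (f : 'I_m -> 'I_n) : bool :=
  [forall i : 'I_m, forall j : 'I_m, (i < j) ==> (f i < f j)].

(* Ordinals index columns and rows from 0, coordinates start from 1. *)
Definition cell_at m n (i : 'I_m) (j : 'I_n) : cell := (i.+1, j.+1).

Definition occurrence (S T : cell_shape)
    (c : {ffun 'I_(width T) -> 'I_(width S)})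
    (r : {ffun 'I_(height T) -> 'I_(height S)}) : bool :=
  [&& increasing c, increasing r
    & [forall i, forall j,
        (cell_at i j \in T) == (cell_at (c i) (r j) \in S)]].

Definition contains (S T : cell_shape) : bool :=
  [exists c, exists r, @occurrence S T c r].

Definition square (k : nat) : cell_shape :=
  [fset ((i, j) : cell) | i in iota 1 k, j in iota 1 k].

Definition D_shape : cell_shape := square 3 `\` [fset (1, 3); (3, 1)].

Definition D_free (S : cell_shape) : bool := ~~ contains S D_shape.

Definition filling (S : cell_shape) : Type := {ffun S -> bool}.
HB.instance Definition _ (S : cell_shape) := Finite.on (filling S).

(* false when p is not a cell of S *)
Definition one_cell (S : cell_shape) (phi : filling S) (p : cell) : bool :=
  if insub p is Some u then phi u else false.

Definition transversal (S : cell_shape) (phi : filling S) : bool :=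
  [forall j : 'I_(height S), #|[set u : S | phi u & (val u).2 == j.+1]| == 1]
  && [forall i : 'I_(width S), #|[set u : S | phi u & (val u).1 == i.+1]| == 1].

Definition fill_contains (S T : cell_shape) (phiS : filling S) (phiT : filling T)
    : bool :=
  [exists c, exists r, @occurrence S T c r &&
    [forall i, forall j,
      one_cell phiT (cell_at i j) ==> one_cell phiS (cell_at (c i) (r j))]].

Definition iota_fill (k : nat) : filling (square k) :=
  [ffun u => (val u).1 == (val u).2].

Definition delta_fill (k : nat) : filling (square k) :=
  [ffun u => (val u).2 == k.+1 - (val u).1].

Definition Tr (S T : cell_shape) (pi : filling T) : nat :=
  #|[set phi : filling S | transversal phi && ~~ fill_contains phi pi]|.

(* Main.v *)
Require Import Defs.
From mathcomp Require Import all_boot finmap.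
From mathcomp Require Import zify.
From mathcomp Require boolp.

(* Fomin growth diagrams.  Attach to each vertex of a rectangle carrying a
   partial permutation the Young diagram given by the local rules from one
   corner; its first row and first column have the lengths of the longest
   chains of either kind, and transposing it amounts to reflecting the filling.
   The local rules being invertible, a Ferrers shape filled column by column,
   rows being dropped once they are complete, is encoded by an oscillating
   sequence of Young diagrams, and transposing all of these exchanges the two
   avoidance conditions.  A D-free skew shape is a chain of Ferrers shapes,
   alternately facing right and upwards, two consecutive ones sharing a wide or
   a tall rectangle.  In such a rectangle the part that is already filled is
   reflected, together with its tableau, and the remaining part is replaced by
   the reflected one up to dual equivalence, which turns row tableaux into
   column tableaux; one then goes on with the transposed shape. *)

Set Implicit Arguments.
Unset Strict Implicit.
Unset Printing Implicit Defensive.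

Local Open Scope fset_scope.
Local Open Scope nat_scope.

(** * Young diagrams and the local rule *)

(** The number of partial fillings with a given tableau on the active rows depends only on the shape
    of that tableau, up to transposition. Hence [transferable] leaves the target tableau free:
    adding a column, dropping a row and turning all work backwards, from the tableau wanted at the
    next stage to the one requested at the previous stage. Shapes suffice to control avoidance
    because an occurrence needs a full square of cells of [S]; if it uses a new column, it lies in
    the active rows and is a mere chain there. The obstacle is the turn: the tableau that matters
    next runs along another side of the rectangle and is read from the opposite corner, so
    transposing the diagrams along the first side does not transpose those along the second.
    Reflection transposes the shape of the whole rectangle whatever the tableaux are, and D-freeness
    guarantees that the rectangle is full. Only injections are built: the argument is symmetric in
    the two patterns, so two inequalities give the equality. *)

Definition diagram := {fset nat * nat}.

Definition young (A : diagram) : Prop :=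
  forall r s r' s', (r, s) \in A -> r' <= r -> s' <= s -> (r', s') \in A.

Definition row_len (A : diagram) (r : nat) : nat :=
  \max_(x <- A | x.1 == r) x.2.+1.

Definition tr (A : diagram) : diagram := [fset (x.2, x.1) | x in A].

Lemma mem_tr A r s : ((r, s) \in tr A) = ((s, r) \in A).
Proof.
apply/imfsetP/idP => [[[u v]] /= uvA [-> ->] //|srA].
by exists (s, r).
Qed.

Lemma trK : involutive tr.
Proof. by move=> A; apply/fsetP => -[r s]; rewrite !mem_tr. Qed.

Lemma tr0 : tr fset0 = fset0.
Proof. by apply/fsetP => -[r s]; rewrite mem_tr !inE. Qed.

Lemma trU1 r s A : tr ((r, s) |` A) = (s, r) |` tr A.
Proof.
apply/fsetP => -[u v].
by rewrite mem_tr !in_fset1U mem_tr !xpair_eqE andbC.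
Qed.

Lemma young_tr A : young A -> young (tr A).
Proof. by move=> yA r s r' s'; rewrite !mem_tr => /yA h ? ?; apply: h. Qed.

Lemma young0 : young fset0.
Proof. by move=> r s r' s'; rewrite inE. Qed.

Lemma mem_row_len A r s : young A -> (s < row_len A r) = ((r, s) \in A).
Proof.
move=> yA; apply/idP/idP => [|rsA].
  rewrite ltnNge => /bigmax_leqP_seq h; apply/negPn/negP => rsA; apply: h.
  move=> [u v] uvA /= /eqP ur; rewrite ltnNge; apply/negP => sv.
  by move: rsA; rewrite (yA u v) // ur.
exact: (@leq_bigmax_seq _ _ (fun x => x.1 == r) (fun x => x.2.+1) (r, s)).
Qed.

Lemma row_len_eq A r s : young A ->
  (r, s) \notin A -> s = 0 \/ (r, s.-1) \in A -> row_len A r = s.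
Proof.
move=> yA; rewrite -!mem_row_len //; case: s => [|s] /=; last lia.
by move=> ? _; lia.
Qed.

Definition addable (A : diagram) (x : nat * nat) : Prop :=
  x \notin A /\ young (x |` A).

Lemma addable_tr A r s : addable A (r, s) -> addable (tr A) (s, r).
Proof. by case=> rsA /young_tr; rewrite trU1; split; rewrite ?mem_tr. Qed.

Lemma addableP A r s : young A ->
  addable A (r, s) <->
  [/\ (r, s) \notin A, r = 0 \/ (r.-1, s) \in A & s = 0 \/ (r, s.-1) \in A].
Proof.
move=> yA; split.
  case=> nA yrs; split => //.
    case: r nA yrs => [|r] nA yrs; [by left | right].
    have := yrs r.+1 s r s; rewrite !in_fset1U eqxx /= !xpair_eqE.
    by move=> /(_ isT (leqnSn _) (leqnn _)) /orP[/andP[/eqP] |//]; lia.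
  case: s nA yrs => [|s] nA yrs; [by left | right].
  have := yrs r s.+1 r s; rewrite !in_fset1U eqxx /= !xpair_eqE.
  by move=> /(_ isT (leqnn _) (leqnSn _)) /orP[/andP[_ /eqP] |//]; lia.
case=> nA hr hs; split => // u v u' v'; rewrite !in_fset1U !xpair_eqE.
case/orP => [/andP[/eqP-> /eqP->]|uvA] hu hv; last by rewrite (yA _ _ _ _ uvA) ?orbT.
have [->|nu] := eqVneq u' r; have [->|nv] := eqVneq v' s => //=.
- by case: hs => [?|/yA]; [lia | apply; lia].
- by case: hr => [?|/yA]; [lia | apply; lia].
- by case: hr => [?|/yA]; [lia | apply; lia].
Qed.

Lemma addable_row_len A r s : young A -> addable A (r, s) -> s = row_len A r.
Proof. by move=> yA /(addableP _ _ yA)[? ? ?]; rewrite (@row_len_eq A r s). Qed.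

Lemma addable_first_row A : young A -> addable A (0, row_len A 0).
Proof.
move=> yA; apply/addableP => //; rewrite -mem_row_len // ltnn; split => //.
  by left.
rewrite -mem_row_len //; case: (row_len A 0) => [|n]; [by left | by right].
Qed.

Lemma addable_neq A x y : addable A x -> addable A y -> x != y -> addable (x |` A) y.
Proof.
move=> [nx yx] [ny yy] xy; split; first by rewrite in_fset1U negb_or eq_sym xy.
move=> r s r' s'; rewrite fsetUCA !in_fset1U orbA [(_ == y) || _]orbC -orbA.
case/orP => [/eqP rs|h] hr hs.
  have := yx r s r' s'; rewrite !in_fset1U rs eqxx => /(_ isT hr hs).
  by case/orP => ->; rewrite ?orbT.
have := yy r s r' s'; rewrite !in_fset1U => /(_ h hr hs).
by case/orP => ->; rewrite ?orbT.
Qed.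

(* The box bumped into the row below when [x] is added to [A]. *)
Definition bumped (A : diagram) (x : nat * nat) : nat * nat :=
  (x.1.+1, row_len (x |` A) x.1.+1).

Lemma bump_le A x : young A -> addable A x -> (bumped A x).2 <= x.2.
Proof.
case: x => r s yA ax; have [nx _ _] := (addableP _ _ yA).1 ax.
rewrite leqNgt mem_row_len ?in_fset1U ?xpair_eqE; last exact: ax.2.
apply/negP => /orP[/andP[/eqP]|] /=; first lia.
by move=> /yA /(_ (leqnSn _) (leqnn _)) h; rewrite h in nx.
Qed.

Lemma addable_bumped A x : young A -> addable A x -> addable (x |` A) (bumped A x).
Proof.
case: x => r s yA ax; have yx := ax.2; have := bump_le yA ax.
rewrite /bumped /=; set L := row_len _ _ => Ls.
apply/addableP => //; split; first by rewrite -mem_row_len // ltnn.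
  by right; apply: (yx r s) => //; rewrite in_fset1U eqxx.
rewrite -mem_row_len // -/L; case: (L) => [|n]; [by left | by right].
Qed.

Definition step (A B : diagram) : Prop :=
  B = A \/ exists2 x, addable A x & B = x |` A.

Lemma step_young A B : young A -> step A B -> young B.
Proof. by move=> yA [->|[x [_ ?] ->]]. Qed.

Lemma step_tr A B : step A B -> step (tr A) (tr B).
Proof.
case=> [->|[[r s] ax ->]]; [by left | right].
by exists (s, r); [apply: addable_tr | rewrite trU1].
Qed.

Lemma step_refl A : step A A. Proof. by left. Qed.

Lemma step_add A x : addable A x -> step A (x |` A).
Proof. by right; exists x. Qed.

(* Fomin's local rule for a unit square: [A] is at the corner nearest to the
   origin, [B] and [C] at the neighbouring corners, [b] tells whether the square
   carries a 1, and the result is the diagram at the remaining corner. *)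
Definition rule (A B C : diagram) (b : bool) : diagram :=
  let U := B `|` C in
  if b then (0, row_len U 0) |` U
  else if B == C then U `|` [fset (x.1.+1, row_len U x.1.+1) | x in U `\` A]
  else U.

Lemma ruleC A B C b : rule A B C b = rule A C B b.
Proof. by rewrite /rule (fsetUC C B) (eq_sym C B). Qed.

Lemma rule_one A : rule A A A true = (0, row_len A 0) |` A.
Proof. by rewrite /rule fsetUid. Qed.

Lemma rule_nonel A C : step A C -> rule A A C false = C.
Proof.
rewrite /rule; case=> [->|[x [nx _] ->]].
  rewrite eqxx fsetUid fsetDv; apply/fsetP => x; rewrite in_fsetU.
  by apply/orb_idr => /imfsetP[].
have -> : (A == x |` A) = false.
  by apply/eqP => /fsetP /(_ x); rewrite in_fset1U eqxx (negbTE nx).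
by apply/fsetUidPr; rewrite fsubsetUr.
Qed.

Lemma rule_noner A B : step A B -> rule A B A false = B.
Proof. by rewrite ruleC; apply: rule_nonel. Qed.

Lemma fset1U_inj (A : diagram) x y : x \notin A -> x |` A = y |` A -> x = y.
Proof.
move=> nx /fsetP /(_ x); rewrite !in_fset1U eqxx (negbTE nx) !orbF.
by move=> /esym/eqP.
Qed.

Lemma rule_neq A x y : x \notin A -> x != y ->
  rule A (x |` A) (y |` A) false = x |` (y |` A).
Proof.
move=> nx xy; rewrite /rule.
have -> : (x |` A == y |` A) = false.
  by apply/eqP => /(fset1U_inj nx) /eqP; rewrite (negbTE xy).
by apply/fsetP => z; rewrite !inE; do 2 case: (_ == _); case: (_ \in _).
Qed.

Lemma rule_eq A x : x \notin A ->
  rule A (x |` A) (x |` A) false = bumped A x |` (x |` A).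
Proof.
move=> nx; rewrite /rule eqxx fsetUid; apply/fsetP => z.
have -> : (x |` A) `\` A = [fset x].
  by apply/fsetP => y; rewrite !inE; have [->|_] := eqVneq y x; rewrite ?nx //= andNb.
rewrite in_fsetU orbC [RHS]in_fset1U; congr orb.
apply/imfsetP/eqP => [[y /=]|->]; first by rewrite inE => /eqP-> ->.
by exists x; rewrite ?inE.
Qed.

(** The inputs on which [rule] is meaningful. The last condition is what a partial permutation
    provides: a 1 has no other 1 in its row or column. *)
Definition corner (A B C : diagram) (b : bool) : Prop :=
  [/\ young A, step A B, step A C & b -> B = A /\ C = A].

Lemma cornerC A B C b : corner A B C b -> corner A C B b.
Proof. by case=> ? ? ? h; split => // /h[]. Qed.

Lemma corner_step A B C b : corner A B C b -> step B (rule A B C b).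
Proof.
case: b => -[yA sB sC hb].
  case: hb => // -> ->; rewrite rule_one; apply: step_add.
  exact: addable_first_row.
case: sB => [->|[x ax ->]]; first by rewrite rule_nonel.
case: sC => [->|[y ay ->]].
  by rewrite rule_noner; [apply: step_refl | apply: step_add].
have [<-|xy] := eqVneq x y.
  by rewrite rule_eq ?ax.1 //; apply: step_add; apply: addable_bumped.
by rewrite (rule_neq ax.1 xy) fsetUCA; apply: step_add; apply: addable_neq.
Qed.

Lemma add_neq (A : diagram) x : x \notin A -> (x |` A == A) = false.
Proof. by move=> nx; apply/eqP => /fsetP /(_ x); rewrite in_fset1U eqxx (negbTE nx). Qed.

(** A step never disappears when carried across a square, and a 1 creates one. This is why growth
    diagrams detect which rows and columns are occupied. *)
Lemma corner_eq A B C b : corner A B C b -> (rule A B C b == B) = (C == A) && ~~ b.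
Proof.
case: b => -[yA sB sC hb]; rewrite ?andbF ?andbT.
  case: hb => // -> ->; rewrite rule_one; apply: add_neq.
  by case: (addable_first_row yA).
case: sB => [->|[x ax ->]]; first by rewrite rule_nonel.
case: sC => [->|[y ay ->]].
  by rewrite rule_noner ?eqxx //; apply: step_add.
rewrite (add_neq ay.1); have [<-|xy] := eqVneq x y.
  by rewrite rule_eq ?ax.1 //; apply: add_neq; case: (addable_bumped yA ax).
rewrite (rule_neq ax.1 xy) fsetUCA; apply: add_neq.
by case: (addable_neq ax ay xy).
Qed.

Lemma corner_stepr A B C b : corner A B C b -> step C (rule A B C b).
Proof. by move=> /cornerC/corner_step; rewrite ruleC. Qed.

Lemma corner_eqr A B C b : corner A B C b -> (rule A B C b == C) = (B == A) && ~~ b.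
Proof. by move=> /cornerC/corner_eq; rewrite ruleC. Qed.

(** Inverse of the local rule. When [B = C], a box of [D] outside [B] was either bumped out of the
    row above, whose last box is then missing from [A], or put into the first row by a 1. When
    [D = B] as well, nothing is removed. *)
Definition unrule (B C D : diagram) : diagram * bool :=
  if B == C then
    (B `\` [fset (x.1.-1, (row_len B x.1.-1).-1) | x in D `\` B & 0 < x.1],
     (0, row_len B 0) \in D `\` B)
  else (B `&` C, false).

Lemma unrule_rule A B C b : corner A B C b -> unrule B C (rule A B C b) = (A, b).
Proof.
case: b => -[yA sB sC hb].
  case: hb => // -> ->; rewrite rule_one /unrule eqxx.
  have [nz _] := addable_first_row yA.
  congr (_, _); last by rewrite !inE eqxx (negbTE nz).
  apply/fsetP => y; rewrite in_fsetD; apply/andb_idl => _.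
  apply/imfsetP => -[x /=]; rewrite !inE -andbA => /and3P[nx].
  by rewrite (negbTE nx) orbF => /eqP->.
have e1 : B = C -> A = B -> unrule B C B = (A, false).
  move=> <- ->; rewrite /unrule eqxx fsetDv in_fset0; congr (_, _).
  apply/fsetP => y; rewrite in_fsetD; apply/andb_idl => _.
  by apply/imfsetP => -[x /=]; rewrite !inE.
have e2 x : addable A x -> unrule (x |` A) A (x |` A) = (A, false).
  move=> [nx _]; rewrite /unrule add_neq //; congr (_, _).
  by apply/fsetIidPr; rewrite fsubsetUr.
have e3 x : addable A x -> unrule A (x |` A) (x |` A) = (A, false).
  move=> [nx _]; rewrite /unrule eq_sym add_neq //; congr (_, _).
  by apply/fsetIidPl; rewrite fsubsetUr.
case: sB => [eB|[x ax ->]].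
  subst B; rewrite rule_nonel //.
  by case: sC => [eC|[y ay ->]]; [subst C; apply: e1 | apply: e3].
case: sC => [->|[y ay ->]].
  by rewrite rule_noner; [apply: e2 | apply: step_add].
have [<-|xy] := eqVneq x y.
  rewrite rule_eq ?ax.1 // /unrule eqxx.
  have [nb _] := addable_bumped yA ax.
  have -> : (bumped A x |` (x |` A)) `\` (x |` A) = [fset bumped A x].
    apply/fsetP => z; rewrite in_fsetD [z \in _ |` (_ |` _)]in_fset1U in_fset1.
    by have [->|_] := eqVneq z (bumped A x); rewrite ?nb //= andNb.
  congr (_, _); last by rewrite in_fset1 /bumped xpair_eqE.
  apply/fsetP => z; rewrite in_fsetD in_fset1U.
  have hx : (row_len (x |` A) x.1).-1 = x.2.
    case: x ax {nb} => r s ax /=; rewrite (@row_len_eq _ r s.+1) //; first exact: ax.2.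
      have [n _ _] := (addableP _ _ yA).1 ax.
      rewrite in_fset1U xpair_eqE eqxx /= eqn_leq ltnn /=.
      by apply/negP => /yA /(_ (leqnn r) (leqnSn s)) h; rewrite h in n.
    by right; rewrite in_fset1U eqxx.
  have -> : (z \in [fset (x0.1.-1, (row_len (x |` A) x0.1.-1).-1)
         | x0 in [fset bumped A x] & 0 < x0.1]) = (z == x).
    apply/imfsetP/eqP => [[u /=]|->].
      by rewrite !inE => /andP[/eqP-> _]; rewrite /= hx; case: (x).
    by exists (bumped A x); rewrite ?inE ?eqxx //= hx; case: (x).
  by have [->|] := eqVneq z x; rewrite //= (negbTE ax.1).
rewrite rule_neq ?ax.1 // /unrule.
have -> : (x |` A == y |` A) = false.
  by apply/eqP => /(fset1U_inj ax.1) /eqP; rewrite (negbTE xy).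
congr (_, _); apply/fsetP => z; rewrite !inE.
have [->|_] := eqVneq z x; first by rewrite (negbTE xy) (negbTE ax.1).
by case: (z == y); case: (z \in A).
Qed.

Lemma young_fsetI A B : young A -> young B -> young (A `&` B).
Proof.
move=> yA yB r s r' s'; rewrite !inE => /andP[/yA hA /yB hB] hr hs.
by rewrite hA ?hB.
Qed.

Lemma rule_unrule B C D : young B -> young C -> step B D -> step C D ->
  let: (A, b) := unrule B C D in corner A B C b /\ rule A B C b = D.
Proof.
move=> yB yC sB sC; rewrite /unrule; have [eBC|nBC] := eqVneq B C; last first.
  have H x E : addable E x -> (x |` E) `&` E = E.
    by move=> _; apply/fsetIidPr; rewrite fsubsetUr.
  have H' x E : addable E x -> E `&` (x |` E) = E.
    by move=> _; apply/fsetIidPl; rewrite fsubsetUr.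
  case: sB => [eD|[x ax eD]].
    subst D; case: sC => [eB|[y ay eB]]; first by rewrite eB eqxx in nBC.
    subst B; rewrite (H _ _ ay); split; last by rewrite rule_noner //; apply: step_add.
    by split => //; [apply: step_add | apply: step_refl].
  subst D; case: sC => [eC|[y ay eC]].
    subst C; rewrite (H' _ _ ax); split; last by rewrite rule_nonel //; apply: step_add.
    by split => //; [apply: step_refl | apply: step_add].
  have xy : x != y.
    apply: contraNneq nBC => exy; subst y; apply/eqP/fsetP => z.
    move/fsetP/(_ z): eC; rewrite !in_fset1U; have [->|_] //= := eqVneq z x.
    by rewrite (negbTE ax.1) (negbTE ay.1).
  have yB' : y \in B.
    by move/fsetP/(_ y): eC; rewrite !in_fset1U eqxx /= eq_sym (negbTE xy).
  have xC' : x \in C.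
    by move/fsetP/(_ x): eC; rewrite !in_fset1U eqxx /= (negbTE xy).
  have eB : B = y |` (B `&` C).
    apply/fsetP => z; move/fsetP/(_ z): eC; rewrite !inE.
    have [->|_] := eqVneq z y; first by rewrite yB'.
    have [->|_] /= := eqVneq z x; first by rewrite (negbTE ax.1).
    by move=> ->; rewrite andbb.
  have eC' : C = x |` (B `&` C).
    apply/fsetP => z; move/fsetP/(_ z): eC; rewrite !inE.
    have [->|_] := eqVneq z x; first by rewrite xC'.
    have [->|_] /= := eqVneq z y; first by rewrite (negbTE ay.1) andbF.
    by move=> ->; rewrite andbb.
  have ny : y \notin B `&` C by rewrite inE (negbTE ay.1) andbF.
  have nx : x \notin B `&` C by rewrite inE (negbTE ax.1).
  split; last first.
    have yx : y != x by rewrite eq_sym.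
    by have := rule_neq ny yx; rewrite -eB -eC' eC.
  split => //; first exact: young_fsetI.
    by right; exists y => //; split; rewrite -?eB.
  by right; exists x => //; split; rewrite -?eC'.
subst C; case: sB => [->|[[r s] ax ->]].
  rewrite fsetDv in_fset0.
  have -> : B `\` [fset (x.1.-1, (row_len B x.1.-1).-1)
      | x in (fset0 : diagram) & 0 < x.1] = B.
    apply/fsetP => y; rewrite in_fsetD; apply/andb_idl => _.
    by apply/imfsetP => -[x /=]; rewrite !inE.
  by split; [split => //; apply: step_refl | rewrite rule_nonel //; apply: step_refl].
have -> : ((r, s) |` B) `\` B = [fset (r, s)].
  apply/fsetP => y; rewrite !inE.
  by have [->|_] := eqVneq y (r, s); rewrite ?ax.1 //= andNb.
have es := addable_row_len yB ax.
case: r ax es => [|r] ax es.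
  rewrite in_fset1 -es eqxx.
  have -> : B `\` [fset (x.1.-1, (row_len B x.1.-1).-1)
      | x in [fset (0, s)] & 0 < x.1] = B.
    apply/fsetP => y; rewrite in_fsetD; apply/andb_idl => _.
    by apply/imfsetP => -[x /=]; rewrite !inE => /andP[/eqP->].
  by split; [split => //; apply: step_refl | rewrite rule_one -es].
rewrite in_fset1 xpair_eqE /=.
have -> : [fset (x.1.-1, (row_len B x.1.-1).-1)
      | x in [fset (r.+1, s)] & 0 < x.1] = [fset (r, (row_len B r).-1)].
  apply/fsetP => y; rewrite in_fset1.
  apply/imfsetP/eqP => [[x /=]|->]; first by rewrite !inE => /andP[/eqP-> _] ->.
  by exists (r.+1, s); rewrite //= !inE eqxx.
(* The box to remove ends row [r]. What remains is a diagram because row [r.+1] of [B], of length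
   [s], is strictly shorter than row [r]. *)
set x := (r, _).
have [n1 h2 h3] := (addableP _ _ yB).1 ax.
have sr : s < row_len B r by rewrite mem_row_len //; case: h2.
have xB : x \in B by rewrite /x -mem_row_len //; lia.
have eB : B = x |` (B `\` [fset x]) by rewrite fsetD1K.
have nx : x \notin B `\` [fset x] by rewrite !inE eqxx.
have yA : young (B `\` [fset x]).
  move=> u v u' v'; rewrite !inE => /andP[nuv uvB] hu hv.
  rewrite (yB _ _ _ _ uvB hu hv) andbT; apply: contraNneq nuv => -[eu ev].
  rewrite !xpair_eqE -mem_row_len // in uvB *.
  have [eur|ur] := eqVneq u r; first by subst u; lia.
  have := yB u v r.+1 v; rewrite -!mem_row_len //; lia.
split.
  by split => //; right; exists x => //; split; rewrite -?eB.
by have := rule_eq nx; rewrite /bumped -eB /= -es.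
Qed.

(** * Growth diagrams and the inverse correspondence *)

Definition pperm (e : nat -> nat -> bool) : Prop :=
  (forall i i' j, e i j -> e i' j -> i = i') /\
  (forall i j j', e i j -> e i j' -> j = j').

Fixpoint growth (e : nat -> nat -> bool) (i : nat) : nat -> diagram :=
  if i is i'.+1 then
    fix col j := if j is j'.+1
      then rule (growth e i' j') (col j') (growth e i' j) (e i' j')
      else fset0
  else fun=> fset0.

Lemma growth0r e i : growth e i 0 = fset0.
Proof. by case: i. Qed.

Lemma growthS e i j : growth e i.+1 j.+1 =
  rule (growth e i j) (growth e i.+1 j) (growth e i j.+1) (e i j).
Proof. by []. Qed.

(** Beyond a vertical line, growth depends on the diagrams along that line and not on the matrix
    before it. Part of a matrix can thus be exchanged for another one with the same border, even one
    of a different width. *)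
Lemma growth_shift e e' c m d n :
  (forall j, j <= n -> growth e c j = growth e' m j) ->
  (forall i j, i < d -> j < n -> e (c + i) j = e' (m + i) j) ->
  forall i j, i <= d -> j <= n -> growth e (c + i) j = growth e' (m + i) j.
Proof.
move=> h0 he; elim=> [|i IHi]; first by move=> j _ jn; rewrite !addn0 h0.
elim=> [|j IHj] id jn; first by rewrite !growth0r.
by rewrite !addnS !growthS -!addnS IHj // ?IHi ?he //; lia.
Qed.

Lemma growth_ext e e' c n :
  (forall i j, i < c -> j < n -> e i j = e' i j) ->
  forall i j, i <= c -> j <= n -> growth e i j = growth e' i j.
Proof. by move=> h i j; rewrite -[i]add0n; apply: growth_shift. Qed.

Lemma growth_flip e i j : growth (fun a b => e b a) i j = growth e j i.
Proof.
elim: i j => [|i IHi] j; first by rewrite growth0r.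
elim: j => [|j IHj] //; rewrite !growthS ruleC.
by rewrite -growthS IHj !IHi.
Qed.

Lemma pperm_flip e : pperm e -> pperm (fun a b => e b a).
Proof. by case=> h1 h2; split => [i i' j | i j j']; [apply: h2 | apply: h1]. Qed.

(** The three facts must be proved together: the corner condition at a 1 needs trivial steps below
    and beside it, which follow from the absence of other 1s in its row and column, and the
    characterization of trivial steps is carried from square to square by [corner_eq]. *)
Lemma growth_inv e : pperm e -> forall i j,
  [/\ corner (growth e i j) (growth e i.+1 j) (growth e i j.+1) (e i j),
      (growth e i.+1 j = growth e i j <-> forall j', j' < j -> ~~ e i j')
    & (growth e i j.+1 = growth e i j <-> forall i', i' < i -> ~~ e i' j)].
Proof.
move=> [p1 p2].
pose Q i j := [/\ young (growth e i j),
  step (growth e i j) (growth e i.+1 j) /\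
   (growth e i.+1 j = growth e i j <-> forall j', j' < j -> ~~ e i j')
  & step (growth e i j) (growth e i j.+1) /\
    (growth e i j.+1 = growth e i j <-> forall i', i' < i -> ~~ e i' j)].
have QE i j : Q i j ->
    corner (growth e i j) (growth e i.+1 j) (growth e i j.+1) (e i j).
  case=> y [s1 c1] [s2 c2]; split => // eij; split.
    by apply/c1 => j' jj'; apply/negP => /(p2 _ _ _ eij); lia.
  by apply/c2 => i' ii'; apply/negP => /(p1 _ _ _ eij); lia.
suff H i j : Q i j by move=> i j; have := H i j; case=> _ [_ c1] [_ c2]; split; auto.
elim: i j => [|i IHi] j.
  split; first (exact young0).
    elim: j => [|j [s c]].
      by rewrite growth0r; split; [apply: step_refl | split].
    have cr : corner (growth e 0 j) (growth e 1 j) (growth e 0 j.+1) (e 0 j).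
      split => //.
        by apply: step_refl.
      move=> e0j; split=> //; apply/c => j' jj'.
      by apply/negP => /(p2 _ _ _ e0j); lia.
    rewrite growthS; split; first exact: corner_stepr cr.
    split => [/eqP|hj].
      rewrite (corner_eqr cr) => /andP[/eqP/c hj nb] j'; rewrite ltnS leq_eqVlt.
      by case/orP => [/eqP->|/hj].
    apply/eqP; rewrite (corner_eqr cr) hj // andbT; apply/eqP/c => j' jj'.
    by apply: hj; lia.
  by split=> //; apply: step_refl.
elim: j => [|j IHj].
  rewrite /Q !growth0r; split; first (exact young0).
    by split; [apply: step_refl | split].
  have := corner_step (QE _ _ (IHi 0)); have := corner_eq (QE _ _ (IHi 0)).
  rewrite -growthS !growth0r => h s; split => //.
  have [_ _ [_ c]] := IHi 0; rewrite growth0r in c.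
  split => [/eqP|hj].
    rewrite h => /andP[/eqP/c hj nb] i'; rewrite ltnS leq_eqVlt.
    by case/orP => [/eqP->|/hj].
  apply/eqP; rewrite h hj // andbT; apply/eqP/c => i' ii'; apply: hj; lia.
have [yj [s1 c1] [s2 c2]] := IHj.
split; first exact: step_young s2.
  have cr := QE _ _ IHj; rewrite [growth e i.+2 _]growthS.
  split; first by apply: corner_stepr.
  split => [/eqP|hj].
    rewrite (corner_eqr cr) => /andP[/eqP/c1 hj nb] j'; rewrite ltnS leq_eqVlt.
    by case/orP => [/eqP->|/hj].
  apply/eqP; rewrite (corner_eqr cr) hj // andbT; apply/eqP/c1 => j' jj'; apply: hj; lia.
have cr := QE _ _ (IHi j.+1); have [_ _ [_ c]] := IHi j.+1.
rewrite [growth e i.+1 j.+2]growthS.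
split; first by apply: corner_step.
split => [/eqP|hj].
  rewrite (corner_eq cr) => /andP[/eqP/c hj nb] i'; rewrite ltnS leq_eqVlt.
  by case/orP => [/eqP->|/hj].
apply/eqP; rewrite (corner_eq cr) hj // andbT; apply/eqP/c => i' ii'; apply: hj; lia.
Qed.

Lemma growth_corner e i j : pperm e ->
  corner (growth e i j) (growth e i.+1 j) (growth e i j.+1) (e i j).
Proof. by move=> pe; have [] := growth_inv pe i j. Qed.

Lemma growth_young e i j : pperm e -> young (growth e i j).
Proof. by move=> pe; have [] := growth_corner i j pe. Qed.

Lemma growth_col_eq e i j : pperm e ->
  growth e i.+1 j = growth e i j <-> forall j', j' < j -> ~~ e i j'.
Proof. by move=> pe; have [] := growth_inv pe i j. Qed.

Lemma growth_row_eq e i j : pperm e ->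
  growth e i j.+1 = growth e i j <-> forall i', i' < i -> ~~ e i' j.
Proof. by move=> pe; have [] := growth_inv pe i j. Qed.

Definition chain (R : nat -> diagram) (n : nat) : Prop :=
  R 0 = fset0 /\ forall j, j < n -> step (R j) (R j.+1).

Lemma chain_young R n j : chain R n -> j <= n -> young (R j).
Proof.
move=> [R0 sR]; elim: j => [|j IHj] jn; first by rewrite R0; apply: young0.
by apply: step_young (sR j jn); apply: IHj; apply: ltnW.
Qed.

Lemma chain_le R n m : chain R n -> m <= n -> chain R m.
Proof. by move=> [R0 sR] mn; split=> // j jm; apply: sR; apply: leq_trans mn. Qed.

Lemma chain_growth_col e i n : pperm e -> chain (growth e i) n.
Proof.
move=> pe; split=> [|j _]; first exact: growth0r.
by have [] := growth_corner i j pe.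
Qed.

(* [uncol R A n] and [unbit R A n] recover the previous column of a growth
   diagram, and the position of the 1 lying between that column and the
   column [R], from [R] and the diagram [A] at level [n] of the previous one. *)
Fixpoint uncol (R : nat -> diagram) (A : diagram) (n : nat) : nat -> diagram :=
  if n is m.+1 then
    fun j => if j == n then A else uncol R (unrule (R m) A (R n)).1 m j
  else fun=> A.

Fixpoint unbit (R : nat -> diagram) (A : diagram) (n : nat) : nat -> bool :=
  if n is m.+1 then
    fun j => if j == m then (unrule (R m) A (R n)).2
             else unbit R (unrule (R m) A (R n)).1 m j
  else fun=> false.

Lemma uncol_last R A n : uncol R A n n = A.
Proof. by case: n => [|n] //=; rewrite eqxx. Qed.

Lemma unbit_lt R A n j : unbit R A n j -> j < n.
Proof.
by elim: n A => [|n IHn] A //=; have [->|_ /IHn] := eqVneq j n; [rewrite ltnS|lia].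
Qed.

Lemma uncolP R A n : chain R n -> young A -> step A (R n) ->
  [/\ chain (uncol R A n) n,
      forall j, j < n ->
        corner (uncol R A n j) (R j) (uncol R A n j.+1) (unbit R A n j) /\
        rule (uncol R A n j) (R j) (uncol R A n j.+1) (unbit R A n j) = R j.+1,
      forall j j', unbit R A n j -> unbit R A n j' -> j = j'
    & A = R n -> forall j, ~~ unbit R A n j].
Proof.
elim: n A => [|n IHn] A cR yA sA.
  split=> //; split=> //=.
  by case: sA; rewrite cR.1 // => -[x _ /fsetP/(_ x)]; rewrite in_fset1U eqxx inE.
have cRn := chain_le cR (leqnSn n).
have := rule_unrule (chain_young cRn (leqnn n)) yA (cR.2 n (leqnn _)) sA.
rewrite /=; case: (unrule _ _ _) => A' b /= [cr rA].
have [yA' sA' sA'A hb] := cr.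
have [cL hL uL nL] := IHn A' cRn yA' sA'.
split.
- split; first by rewrite cL.1.
  move=> j; rewrite ltnS leq_eqVlt eqSS => /orP[/eqP->|jn].
    by rewrite eqxx ltn_eqF // uncol_last.
  by rewrite !ltn_eqF ?ltnS //; [apply: cL.2 | apply: ltnW].
- move=> j; rewrite ltnS leq_eqVlt eqSS => /orP[/eqP->|jn].
    by rewrite eqxx ltn_eqF // uncol_last.
  by rewrite !ltn_eqF ?ltnS //; [apply: hL | apply: ltnW].
(* A 1 at the top level forces [A' = R n], and two columns agreeing at some level have no 1 between
   them at lower levels. *)
- have hb' j : b -> ~~ unbit R A' n j by move=> /hb[e1 e2]; apply: nL.
  move=> j j'; have [->|nj] := eqVneq j n; have [->|nj'] := eqVneq j' n => //.
  + by move=> /hb' h; rewrite (negbTE (h j')).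
  + by move=> hj /hb' h; rewrite (negbTE (h j)) in hj.
  + exact: uL.
- move=> eA; have := corner_eqr cr; rewrite rA eA eqxx.
  move=> /esym/andP[/eqP eR nb] j.
  by have [_|_] := eqVneq j n; [exact: nb | apply: nL].
Qed.

Lemma uncol_uniq R A n L b : L n = A ->
  (forall j, j < n -> corner (L j) (R j) (L j.+1) (b j) /\
    rule (L j) (R j) (L j.+1) (b j) = R j.+1) ->
  (forall j, j <= n -> L j = uncol R A n j) /\
  (forall j, j < n -> b j = unbit R A n j).
Proof.
elim: n A => [|n IHn] A LA h.
  by split => // j; rewrite leqn0 => /eqP->.
have [cr er] := h n (leqnn _).
have := unrule_rule cr; rewrite er LA => eu.
have [|h1 h2] := IHn (L n) erefl; first by move=> j jn; apply: h; lia.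
rewrite /= eu /=; split=> j jn.
  have [->//|nj] := eqVneq j n.+1; apply: h1; lia.
have [->//|nj] := eqVneq j n; apply: h2; lia.
Qed.

(* The inverse Robinson-Schensted correspondence: the 0-1 matrix whose growth
   diagram has right border [R] and bottom border [Q]. *)
Fixpoint unrsk (c n : nat) (R Q : nat -> diagram) : nat -> nat -> bool :=
  if c is d.+1 then
    fun i j => if i == d then unbit R (Q d) n j
               else unrsk d n (uncol R (Q d) n) Q i j
  else fun _ _ => false.

Lemma unrskP c n R Q : chain R n -> chain Q c -> R n = Q c ->
  let e := unrsk c n R Q in
  [/\ pperm e, forall i j, e i j -> i < c /\ j < n,
      forall j, j <= n -> growth e c j = R j
    & forall i, i <= c -> growth e i n = Q i].
Proof.
elim: c R => [|c IHc] R cR cQ RQ /=.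
  split=> // [j jn|i]; last by rewrite leqn0 => /eqP->; rewrite cQ.1.
  (* [R] ends in [Q 0], which is empty, and steps only add boxes. *)
  have R0 m : m <= n -> R (n - m) = fset0.
    elim: m => [|m IHm] mn; first by rewrite subn0 RQ cQ.1.
    have := cR.2 (n - m.+1) ltac:(lia).
    rewrite (_ : (n - m.+1).+1 = n - m); last lia.
    rewrite IHm; last lia.
    case=> [//|[x _ /fsetP/(_ x)]]; by rewrite in_fset1U eqxx inE.
  by rewrite -[j](subKn jn) R0 // leq_subr.
have sA : step (Q c) (R n) by rewrite RQ; apply: cQ.2.
have yA : young (Q c) by apply: chain_young cQ _; apply: leqnSn.
have [cL hL uL _] := uncolP cR yA sA.
have [|[p1 p2] ebd eL eQ] := IHc (uncol R (Q c) n) cL (chain_le cQ (leqnSn c)).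
  exact: uncol_last.
set e' := unrsk c n _ Q in p1 p2 ebd eL eQ *.
set e := fun i j => _.
have ee' i j : i < c -> e i j = e' i j by move=> ic; rewrite /e ltn_eqF.
have ge i j : i <= c -> growth e i j = growth e' i j.
  by move=> ic; apply: (growth_ext (c := c) (n := j)) => // i' j' ? _; apply: ee'.
have gR j : j <= n -> growth e c.+1 j = R j.
  elim: j => [|j IHj] jn; first by rewrite growth0r cR.1.
  rewrite growthS IHj ?ge ?eL // 1?ltnW // /e eqxx.
  by have [_ ->] := hL j jn.
(* At a 1 of the last column the previous column has a trivial step, so that row is empty in all
   earlier columns. *)
have nob i j : unbit R (Q c) n j -> ~~ e' i j.
  move=> bj; have jn := unbit_lt bj; apply/negP => eij.
  have [ic _] := ebd _ _ eij.
  have [[_ _ _ /(_ bj)[_ e1]] _] := hL j jn.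
  rewrite -!eL // in e1; last by apply: ltnW.
  by have /(growth_row_eq c j (conj p1 p2))/(_ i ic) := e1; rewrite eij.
split=> //.
- split=> [i i' j|i j j']; rewrite /e.
    have [->|ni] := eqVneq i c; have [->|ni'] := eqVneq i' c => //.
    + by move=> /(nob i') /negbTE ->.
    + by move=> h /(nob i); rewrite h.
    + exact: p1.
  by have [_|_] := eqVneq i c; [apply: uL | apply: p2].
- move=> i j; rewrite /e; have [->|ni] := eqVneq i c; first by move=> /unbit_lt.
  by move=> /ebd[]; split=> //; lia.
- move=> i; rewrite leq_eqVlt ltnS => /orP[/eqP->|ic]; first by rewrite gR.
  by rewrite ge // eQ.
Qed.

(** Columns are peeled off from the right; [unrule] leaves no choice at any square. *)
Lemma growth_uniq e e' c n : pperm e -> pperm e' ->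
  (forall j, j <= n -> growth e c j = growth e' c j) ->
  (forall i, i <= c -> growth e i n = growth e' i n) ->
  forall i j, i < c -> j < n -> e i j = e' i j.
Proof.
move=> pe pe'; elim: c => [|c IHc] // hR hQ.
have [h1 h2] := @uncol_uniq (growth e c.+1) (growth e c n) n (growth e c) (e c)
  erefl (fun j _ => conj (growth_corner c j pe) (esym (growthS e c j))).
have [||h1' h2'] := @uncol_uniq (growth e c.+1) (growth e c n) n (growth e' c) (e' c).
- by rewrite hQ.
- move=> j jn; rewrite !hR ?growthS //; last exact: ltnW.
  by split=> //; apply: growth_corner.
move=> i j; rewrite ltnS leq_eqVlt => /orP[/eqP->|ic] jn.
  by rewrite h2 // h2'.
apply: IHc => // [k kn|k kc]; first by rewrite h1 // h1'.
by apply: hQ; apply: leqW.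
Qed.

(** * Reflection transposes the shape *)

Arguments bumped : simpl never.

(** The local rule of column insertion, [rule] being that of row insertion. *)
Definition trule (A B C : diagram) (b : bool) : diagram :=
  tr (rule (tr A) (tr B) (tr C) b).

Definition cbumped (A : diagram) (x : nat * nat) : nat * nat :=
  let y := bumped (tr A) (x.2, x.1) in (y.2, y.1).

Lemma trule_nonel A C : step A C -> trule A A C false = C.
Proof. by move=> /step_tr s; rewrite /trule rule_nonel // trK. Qed.

Lemma trule_noner A B : step A B -> trule A B A false = B.
Proof. by move=> /step_tr s; rewrite /trule rule_noner // trK. Qed.

Lemma trule_neq A x y : x \notin A -> x != y ->
  trule A (x |` A) (y |` A) false = x |` (y |` A).
Proof.
case: x y => [r s] [u v] nx xy; rewrite /trule !trU1 rule_neq ?mem_tr ?trU1 ?trU1 ?trK //.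
by move: xy; rewrite !xpair_eqE andbC.
Qed.

Lemma trule_eq A x : x \notin A ->
  trule A (x |` A) (x |` A) false = cbumped A x |` (x |` A).
Proof.
case: x => r s nx; rewrite /trule !trU1 rule_eq ?mem_tr // /cbumped.
by case: (bumped _ _) => u v; rewrite !trU1 trK.
Qed.

Lemma addable_cbumped A x : young A -> addable A x -> addable (x |` A) (cbumped A x).
Proof.
case: x => r s yA /addable_tr ax.
have := addable_bumped (young_tr yA) ax; rewrite /cbumped.
by case: (bumped _ _) => u v /addable_tr; rewrite trU1 trK.
Qed.

Lemma bumpedE A x y : young (x |` A) -> addable (x |` A) y -> y.1 = x.1.+1 -> y = bumped A x.
Proof.
case: y => u v yx ay /= eu; subst u; rewrite /bumped; congr (_, _).
exact: addable_row_len ay.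
Qed.

Lemma cbumpedE A x y : young (x |` A) -> addable (x |` A) y -> y.2 = x.2.+1 -> y = cbumped A x.
Proof.
case: x y => r s [u v] yx ay /= ev.
have := @bumpedE (tr A) (s, r) (v, u); rewrite -trU1 => /(_ (young_tr yx)) h.
by rewrite /cbumped -h //; apply: addable_tr.
Qed.

Definition domino (x z : nat * nat) : Prop :=
  z = (x.1.+1, x.2) \/ z = (x.1, x.2.+1).

(* Four diagrams at the corners of a square satisfying the local rule of jeu de
   taquin: if both intermediate diagrams agree, the two added boxes are adjacent. *)
Inductive jdt_square : diagram -> diagram -> diagram -> diagram -> Prop :=
| Jdt_none A of young A : jdt_square A A A A
| Jdt_left A x of young A & addable A x : jdt_square A (x |` A) A (x |` A)
| Jdt_right A y of young A & addable A y : jdt_square A A (y |` A) (y |` A)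
| Jdt_neq A x y of young A & addable A x & addable A y & x != y :
    jdt_square A (x |` A) (y |` A) (x |` (y |` A))
| Jdt_eq A x z of young A & addable A x & addable (x |` A) z & domino x z :
    jdt_square A (x |` A) (x |` A) (z |` (x |` A)).

Lemma jdt_square_tr A B C D :
  jdt_square A B C D -> jdt_square (tr A) (tr C) (tr B) (tr D).
Proof.
case=> {A B C D} [A yA|A [r s] yA ax|A [r s] yA ax|A [r s] [u v] yA ax ay xy
  |A [r s] [u v] yA ax az xz].
- by apply: Jdt_none; apply: young_tr.
- by rewrite !trU1; apply: Jdt_right; [apply: young_tr | apply: addable_tr].
- by rewrite !trU1; apply: Jdt_left; [apply: young_tr | apply: addable_tr].
- rewrite !trU1 fsetUCA; apply: Jdt_neq; [exact: young_tr|exact: addable_tr|exact: addable_tr|].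
  by move: xy; rewrite !xpair_eqE andbC eq_sym [r == _]eq_sym.
- rewrite !trU1; apply: Jdt_eq; [exact: young_tr|exact: addable_tr| |].
    by rewrite -trU1; apply: addable_tr.
  by case: xz => -[-> ->]; [right | left].
Qed.

(** [A], [B], [C], [D] form the lower horizontal face and [A1] lies above [A]. One pair of parallel
    vertical faces obeys column insertion, the other row insertion. The claim is that both ways to
    reach the last vertex agree and that the upper face is again a jeu de taquin square. *)
Definition cube (A B C D A1 : diagram) : Prop :=
  let B1 := trule A B A1 false in
  let C1 := rule A C A1 false in
  let D1 := rule B D B1 false in
  D1 = trule C D C1 false /\ jdt_square A1 B1 C1 D1.

Lemma cube_tr A B C D A1 : cube (tr A) (tr C) (tr B) (tr D) (tr A1) -> cube A B C D A1.
Proof.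
rewrite /cube /trule !trK => -[e j]; split.
  by move: e => /(congr1 tr); rewrite !trK => <-.
by move: j => /jdt_square_tr; rewrite !trK e !trK.
Qed.

Lemma cube_neq A x y : young A -> addable A x -> addable A y -> x != y ->
  cube A (x |` A) (y |` A) (x |` (y |` A)) (x |` A).
Proof.
move=> yA ax ay xy; rewrite /cube trule_eq ?ax.1 // [rule A _ _ _]ruleC rule_neq ?ax.1 //.
have yx := ax.2; have aw := addable_cbumped yA ax.
have axy : addable (x |` A) y by apply: addable_neq.
set w := cbumped A x in aw *.
have exy : x |` (y |` A) = y |` (x |` A) by rewrite fsetUCA.
have nxy : x \notin y |` A by rewrite in_fset1U negb_or xy ax.1.
rewrite (trule_eq nxy) exy; have [ew|nw] := eqVneq w y; last first.
  rewrite rule_neq ?axy.1 // 1?eq_sym //.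
  have -> : cbumped (y |` A) x = w.
    apply/esym/cbumpedE; rewrite ?exy //; first exact: axy.2.
    by apply: addable_neq => //; rewrite eq_sym.
  split; first by rewrite fsetUCA.
  by rewrite [y |` (w |` _)]fsetUCA; apply: Jdt_neq.
rewrite ew rule_eq ?axy.1 //; have av := addable_bumped yx axy.
have e2 : y.2 = x.2.+1 by rewrite -ew.
(* Here the column bump of [x] lands on [y], in the next column and strictly above [x]. Once [x] is
   added, the row below [y] ends exactly under the left neighbour of [y], so the row bump of [y]
   falls straight down. *)
have hv : (bumped (x |` A) y).2 = y.2.
  case: x y ax ay axy yx nxy exy e2 {w aw ew xy av} => r s [u v] ax ay axy yx nxy exy /= e2.
  subst v; have [n1 _ [//|h1]] := (addableP _ _ yA).1 ay.
  have [n2 _ _] := (addableP _ _ yA).1 ax.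
  have ur : u < r by rewrite ltnNge; apply/negP => ru; rewrite (yA u s r s h1) in n2.
  apply: row_len_eq; first exact: axy.2.
    rewrite !in_fset1U !xpair_eqE !negb_or; apply/and3P; split; try lia.
    by apply: contra n1 => /yA; apply; lia.
  by right; rewrite in_fset1U; apply/orP; right; apply: (yx r s); rewrite ?in_fset1U ?eqxx //=.
have -> : cbumped (y |` A) x = bumped (x |` A) y.
  by apply/esym/cbumpedE; rewrite ?exy //; [apply: axy.2 | rewrite hv].
split => //; apply: Jdt_eq => //; left; rewrite -hv.
by rewrite {1}[bumped _ _]surjective_pairing.
Qed.

Lemma cube_eq A x : young A -> addable A x -> addable (x |` A) (x.1.+1, x.2) ->
  cube A (x |` A) (x |` A) ((x.1.+1, x.2) |` (x |` A)) (x |` A).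
Proof.
move=> yA ax az; rewrite /cube trule_eq ?ax.1 // rule_eq ?ax.1 //.
have yx := ax.2; have aw := addable_cbumped yA ax.
set z := (x.1.+1, x.2) in az *; set w := cbumped A x in aw *.
have -> : bumped A x = z by apply/esym/bumpedE.
have zw : z != w by rewrite eq_sym; apply/eqP => /(congr1 snd) /=; rewrite /w /cbumped /=; lia.
rewrite rule_neq ?az.1 // trule_eq ?az.1 //.
have -> : cbumped (x |` A) z = w.
  by apply/esym/cbumpedE; [exact: az.2 | apply: addable_neq |].
split; first by rewrite fsetUCA.
by rewrite [z |` (w |` _)]fsetUCA; apply: Jdt_neq => //; rewrite eq_sym.
Qed.

Lemma jdt_square_steps A B C D : jdt_square A B C D ->
  [/\ young A, step A B, step A C & step B D /\ step C D].
Proof.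
case=> {A B C D} [A yA|A x yA ax|A x yA ax|A x y yA ax ay xy|A x z yA ax az xz];
  split=> //; try split; try exact: step_refl; try exact: step_add.
- by rewrite fsetUCA; apply: step_add; apply: addable_neq.
- by apply: step_add; apply: addable_neq => //; rewrite eq_sym.
Qed.

Lemma jdt_square_left A B : young A -> step A B -> jdt_square A B A B.
Proof. by move=> yA [->|[x ax ->]]; [apply: Jdt_none | apply: Jdt_left]. Qed.

Lemma jdt_square_right A B : young A -> step A B -> jdt_square A A B B.
Proof. by move=> yA [->|[x ax ->]]; [apply: Jdt_none | apply: Jdt_right]. Qed.

Lemma jdt_cube A B C D A1 : jdt_square A B C D -> step A A1 -> cube A B C D A1.
Proof.
move=> sq sA; have [yA sB sC [sD sD']] := jdt_square_steps sq.
case: sA => [->|[z az ->]].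
  by rewrite /cube trule_noner // rule_noner // rule_noner // trule_noner.
have yA1 := az.2.
case: sq yA az yA1 {sB sC sD sD'} => {A B C D} [A|A x|A x|A x y|A x t] _.
- move=> yA az yA1; have sz := step_add az.
  rewrite /cube trule_nonel // !rule_nonel // trule_nonel //.
  by split=> //; apply: Jdt_none.
- move=> ax yA az yA1; have sz := step_add az; have sx := step_add ax.
  rewrite /cube [rule A A _ _]rule_nonel //.
  have cr : corner (tr A) (tr (x |` A)) (tr (z |` A)) false.
    by split=> //; [apply: young_tr | apply: step_tr | apply: step_tr].
  have s1 : step (x |` A) (trule A (x |` A) (z |` A) false).
    by rewrite -[X in step X]trK; apply: step_tr; apply: corner_step.
  rewrite rule_nonel //; split=> //; apply: jdt_square_left => //.
  by rewrite -[X in step X]trK; apply: step_tr; apply: corner_stepr.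
- move=> ax yA az yA1; have sz := step_add az; have sx := step_add ax.
  rewrite /cube trule_nonel //.
  have cr : corner A (x |` A) (z |` A) false by [].
  rewrite trule_nonel; last exact: corner_step.
  by split=> //; apply: jdt_square_right => //; apply: corner_stepr.
- move=> ax ay xy yA az yA1.
  have [->|zx] := eqVneq z x; first exact: cube_neq.
  have [->|zy] := eqVneq z y.
    apply: cube_tr; case: x y ax ay xy {zx} => [r s] [u v] ax ay xy.
    rewrite fsetUCA !trU1; apply: cube_neq; try exact: addable_tr; first exact: young_tr.
    by move: xy; rewrite !xpair_eqE andbC eq_sym [r == _]eq_sym.
  have xz : x != z by rewrite eq_sym.
  have yz : y != z by rewrite eq_sym.
  rewrite /cube trule_neq ?ax.1 // rule_neq ?ay.1 //.
  have ayx : addable (x |` A) y by apply: addable_neq.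
  have axy : addable (y |` A) x by apply: addable_neq => //; rewrite eq_sym.
  have ayz : addable (z |` A) y by apply: addable_neq.
  have axz : addable (z |` A) x by apply: addable_neq.
  rewrite ![x |` (z |` A)]fsetUCA [in rule _ _ _]fsetUCA.
  rewrite rule_neq ?ayx.1 // [y |` (z |` A)]fsetUCA trule_neq ?axy.1 //.
  split.
    by rewrite fsetUCA [x |` (z |` _)]fsetUCA; congr (_ |` _); rewrite fsetUCA.
  rewrite ![z |` (_ |` A)]fsetUCA [y |` (x |` _)]fsetUCA.
  by apply: Jdt_neq.
- move=> ax at' xt yA az yA1.
  have [->|zx] := eqVneq z x.
    case: xt at' => -> at'; first exact: cube_eq.
    apply: cube_tr; case: x ax at' => r s /= ax /addable_tr; rewrite !trU1 => at'.
    by apply: (@cube_eq _ (s, r)) => //; [apply: young_tr | apply: addable_tr].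
  have tz : t != z.
    apply/eqP => etz; subst t; have n := ax.1; case: z az at' xt {zx yA1} => u v az at'.
    have [_ h1 h2] := (addableP _ _ yA).1 az.
    case: x n ax at' => r s n _ _ [] [? ?]; subst u v.
      by case: h1 => //= h1; rewrite h1 in n.
    by case: h2 => //= h2; rewrite h2 in n.
  have xz : x != z by rewrite eq_sym.
  have ayz : addable (x |` A) z by apply: addable_neq.
  rewrite /cube trule_neq ?ax.1 // rule_neq ?ax.1 // [x |` (z |` A)]fsetUCA.
  rewrite rule_neq ?at'.1 // trule_neq ?at'.1 //; split=> //.
  rewrite [z |` (x |` A)]fsetUCA; apply: Jdt_eq => //.
    by apply: addable_neq.
  by rewrite fsetUCA; apply: addable_neq => //; rewrite eq_sym.
Qed.

(** The cube whose 1 lies in the column added on the left. The 1 contributes a box at the end of the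
    first column; if [C] already has that box, the row bump pushes it down within the first column,
    where column insertion puts it too. *)
Lemma jdt_cube_first A C : young A -> step A C ->
  let B1 := trule A A A true in
  let D1 := rule A C B1 false in
  D1 = trule C C C true /\ jdt_square A B1 C D1.
Proof.
move=> yA sC B1 D1; rewrite /D1 {D1}.
have yC := step_young yA sC.
pose y := (row_len (tr A) 0, 0).
have ay : addable A y.
  by have /addable_tr := addable_first_row (young_tr yA); rewrite trK.
have eB1 : B1 = y |` A by rewrite /B1 /trule rule_one trU1 trK.
have eC z : addable C z -> z.2 = 0 -> trule C C C true = z |` C.
  case: z => u v az /= v0; subst v; rewrite /trule rule_one trU1 trK.
  by rewrite (addable_row_len (young_tr yC) (addable_tr az)).
case: sC => [eCA|[x ax eCA]].
  subst C; rewrite (eC y) // eB1 rule_nonel; last exact: step_add.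
  by split=> //; apply: jdt_square_left => //; apply: step_add.
have [exy|nxy] := eqVneq x y; last first.
  have ayC : addable C y by rewrite eCA; apply: addable_neq.
  rewrite (eC y) // eCA eB1 (rule_neq ax.1 nxy).
  split; first by rewrite fsetUCA.
  by rewrite fsetUCA; apply: Jdt_neq => //; rewrite eq_sym.
have ab := addable_bumped yA ay; have := bump_le yA ay.
rewrite leqn0 => /eqP b0; subst C; rewrite exy in eC *.
rewrite (eC _ ab b0) eB1 rule_eq ?ay.1 //.
split=> //; apply: Jdt_eq => //; left.
by rewrite [bumped A y]surjective_pairing b0.
Qed.

Lemma jdt_cube_last A B : young A -> step A B ->
  let C1 := rule A A A true in
  let D1 := rule B B B true in
  D1 = trule A B C1 false /\ jdt_square A B C1 D1.
Proof.
move=> yA sB C1 D1.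
have [] := jdt_cube_first (young_tr yA) (step_tr sB); rewrite /trule !trK.
rewrite -/C1 -/D1 => -> /jdt_square_tr; rewrite !trK => h; split=> //.
Qed.

Definition shift (k : nat) (e : nat -> nat -> bool) i j := e (k + i) j.

Lemma pperm_shift k e : pperm e -> pperm (shift k e).
Proof.
case=> p1 p2; split=> [i i' j h1 h2|i j j']; last exact: p2.
by apply/eqP; rewrite -(eqn_add2l k); apply/eqP; apply: p1 h1 h2.
Qed.

Lemma growth_shift_first e k d j : (forall j', j' < j -> ~~ e k j') ->
  growth (shift k e) d.+1 j = growth (shift k.+1 e) d j.
Proof.
move=> h; apply: (@growth_shift _ _ 1 0 d j) => // [j' jj'|i j' _ _].
  elim: j' jj' => [|j' IH] jj' //; rewrite growthS IH 1?ltnW //.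
  by rewrite /shift addn0 (negbTE (h j' jj')) rule_nonel //; apply: step_refl.
by rewrite /shift; congr (e _ _); lia.
Qed.

Definition jdt_squares e j : Prop := forall i d,
  jdt_square (growth (shift i.+1 e) d j) (growth (shift i e) d.+1 j)
     (growth (shift i.+1 e) d.+1 j) (growth (shift i e) d.+2 j).

Definition growth_left e j : Prop := forall i d,
  growth (shift i e) d.+1 j.+1 =
     trule (growth (shift i.+1 e) d j) (growth (shift i e) d.+1 j)
       (growth (shift i.+1 e) d j.+1) (e i j).

(* Adding column [i] on the left of an interval of columns obeys the transposed
   local rule.  This is checked on each unit cube of the three-dimensional array
   of shapes (left end, right end, height), whose horizontal faces satisfy jeu
   de taquin. *)
Lemma growth_left_step e j : pperm e -> jdt_squares e j ->
  growth_left e j /\ jdt_squares e j.+1.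
Proof.
move=> pe sq; have [p1 p2] := pe.
pose TR i d := growth (shift i e) d.+1 j.+1 =
     trule (growth (shift i.+1 e) d j) (growth (shift i e) d.+1 j)
       (growth (shift i.+1 e) d j.+1) (e i j).
suff H i d : TR i d -> TR i d.+1 /\
    jdt_square (growth (shift i.+1 e) d j.+1) (growth (shift i e) d.+1 j.+1)
     (growth (shift i.+1 e) d.+1 j.+1) (growth (shift i e) d.+2 j.+1).
  suff T i d : TR i d by split=> // i d; have [] := H i d (T i d).
  elim: d => [|d IHd]; last by have [] := H i d IHd.
  (* Base case: a single column added to an empty interval. Its diagrams have at most one box, so
     both rules agree. *)
  have e0 : shift i e 0 j = e i j by rewrite /shift addn0.
  have [_ s _ hb] := growth_corner 0 j (pperm_shift i pe).
  rewrite /TR growthS e0 in hb *; rewrite [growth _ 0 _]/= [growth _ 0 _]/= in s hb *.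
  rewrite [growth _ 0 _]/= [growth _ 0 _]/=; case: (e i j) hb => [[//|-> _]|_].
    have r0 : row_len fset0 0 = 0.
      by apply: row_len_eq; [exact young0 | rewrite inE | left].
    by rewrite /trule tr0 rule_one r0 trU1 tr0.
  by rewrite rule_noner // trule_noner.
have := sq i d; rewrite /TR.
have ps := pperm_shift i pe; have ps' := pperm_shift i.+1 pe.
have eb : shift i e d.+1 j = e (i.+1 + d) j by rewrite /shift addSnnS.
rewrite [growth _ d.+2 j.+1]growthS eb.
rewrite [growth (shift i.+1 e) d.+1 j.+1]growthS [shift i.+1 e d j]/shift.
have [yA sA1 sA hb] := growth_corner d j ps'.
(* The 1 of row [j] may lie in the leftmost column, in the rightmost column, or in neither. In the
   first two cases, uniqueness in rows and columns makes the adjacent faces degenerate. *)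
case b1 : (e i j) => {}sq.
  have e1 d' : growth (shift i e) d'.+1 j = growth (shift i.+1 e) d' j.
    by apply: growth_shift_first => j' jj'; apply/negP => /(p2 _ _ _ b1); lia.
  have e2 : growth (shift i.+1 e) d j.+1 = growth (shift i.+1 e) d j.
    apply/growth_row_eq => // i' _; apply/negP => /(p1 _ _ _ b1); lia.
  have -> : e (i.+1 + d) j = false by apply/negP => /(p1 _ _ _ b1); lia.
  rewrite !e1 !e2 => ->; rewrite rule_noner //.
  exact: jdt_cube_first.
case b2 : (e (i.+1 + d) j).
  have e1 : growth (shift i.+1 e) d.+1 j = growth (shift i.+1 e) d j.
    apply/growth_col_eq => // j' jj'; apply/negP => /(p2 _ _ _ b2); lia.
  have e2 : growth (shift i e) d.+2 j = growth (shift i e) d.+1 j.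
    apply/growth_col_eq => // j' jj'; rewrite /shift addnS -addSn.
    apply/negP => /(p2 _ _ _ b2); lia.
  have e3 : growth (shift i.+1 e) d j.+1 = growth (shift i.+1 e) d j.
    apply/growth_row_eq => // i' i'd; apply/negP => /(p1 _ _ _ b2); lia.
  rewrite e1 e2 in sq *; rewrite !e3; have [_ sB _ _] := jdt_square_steps sq.
  by rewrite trule_noner // => ->; apply: jdt_cube_last.
by move=> ->; apply: jdt_cube.
Qed.

Lemma growth_left_rule e j : pperm e -> growth_left e j.
Proof.
move=> pe; suff sq : jdt_squares e j by have [] := growth_left_step pe sq.
elim: j => [|j IHj]; last by have [] := growth_left_step pe IHj.
by move=> i d; rewrite !growth0r; apply: Jdt_none; apply: young0.
Qed.

Definition hflip (c : nat) (e : nat -> nat -> bool) i j := (i < c) && e (c - i.+1) j.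
Definition vflip (n : nat) (e : nat -> nat -> bool) i j := (j < n) && e i (n - j.+1).

Lemma pperm_hflip c e : pperm e -> pperm (hflip c e).
Proof.
case=> p1 p2; split=> [i i' j /andP[ic h] /andP[ic' h']|i j j' /andP[_ h] /andP[_ h']].
  by have := p1 _ _ _ h h'; lia.
exact: p2 h h'.
Qed.

Lemma pperm_vflip n e : pperm e -> pperm (vflip n e).
Proof. by move=> /pperm_flip /(pperm_hflip n) /pperm_flip. Qed.

(** The reflected matrix takes in the columns of [e] from the right, each being added on the left of
    an interval, by the transposed rule. The transposed diagrams of these intervals therefore grow
    by the ordinary rule. Only the border [c] is concerned; the diagrams along the other border
    change in a more complicated way. *)
Lemma growth_hflip c e j : pperm e -> growth (hflip c e) c j = tr (growth e c j).
Proof.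
move=> pe; suff H k : k <= c -> growth (hflip c e) k j = tr (growth (shift (c - k) e) k j).
  by rewrite H // subnn.
elim: k j => [|k IHk] j kc; first by rewrite /= tr0.
elim: j => [|j IHj]; first by rewrite !growth0r tr0.
have := @growth_left_rule e j pe (c - k.+1) k.
rewrite (_ : (c - k.+1).+1 = c - k); last lia.
by move=> ->; rewrite [LHS]growthS IHj !IHk ?(ltnW kc) // /trule trK /hflip kc.
Qed.

Lemma growth_vflip n e i : pperm e -> growth (vflip n e) i n = tr (growth e i n).
Proof.
move=> pe; rewrite -growth_flip -[growth e i n]growth_flip.
exact: growth_hflip (pperm_flip pe).
Qed.

(** * Chains *)

Definition lt2 (p q : nat * nat) : bool := (p.1 < q.1) && (p.2 < q.2).

Lemma lt2_trans : transitive lt2.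
Proof.
by move=> q p r /andP[h1 h2] /andP[h3 h4]; rewrite /lt2 (ltn_trans h1 h3) (ltn_trans h2 h4).
Qed.

Lemma mem_rule_row0 A B C k :
  ((0, k) \in rule A B C false) = ((0, k) \in B) || ((0, k) \in C).
Proof.
rewrite /rule; case: (B == C); rewrite !in_fsetU // orb_idr //.
by move=> /imfsetP[x _ []].
Qed.

Lemma sorted_rcons_lt2 s x : sorted lt2 (rcons s x) = sorted lt2 s && all (lt2^~ x) s.
Proof.
by rewrite !(sorted_pairwise lt2_trans) pairwise_rcons andbC.
Qed.

(** Schensted's theorem. A chain in a rectangle either avoids its last row or its last column, or
    ends with a 1 in the extreme square; in the last case that 1 is alone in its row and column and
    lengthens every chain by one. *)
Lemma growth_first_row e c n k : pperm e ->
  (0, k) \in growth e c n <->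
  exists s, [/\ size s = k.+1, sorted lt2 s
    & forall p, p \in s -> [/\ e p.1 p.2, p.1 < c & p.2 < n]].
Proof.
move=> pe; elim: c n k => [|c IHc] n k.
  rewrite inE; split => // -[[|p s] [//= _ _ h]].
  by have [] := h p (mem_head _ _).
elim: n k => [|n IHn] k.
  rewrite growth0r inE; split => // -[[|p s] [//= _ _ h]].
  by have [] := h p (mem_head _ _).
rewrite growthS; have := growth_corner c n pe; case b : (e c n) => cr; last first.
  rewrite mem_rule_row0; split.
    by case/orP => [/IHn|/IHc] [s [h1 h2 h3]]; exists s; split => // p /h3[h4 h5 h6];
      split => //; lia.
  case=> s []; case/lastP: s => [//|s p]; rewrite size_rcons => -[ss].
  rewrite sorted_rcons_lt2 => /andP[s1 /allP s2] h.
  have /h[ep pc pn] : p \in rcons s p by rewrite mem_rcons mem_head.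
  have hp q : q \in rcons s p -> q.1 <= p.1 /\ q.2 <= p.2.
    by rewrite mem_rcons inE => /orP[/eqP-> //|/s2 /andP[/ltnW ? /ltnW ?]].
  (* The extreme square has no 1, so the largest cell of the chain misses the last column or the
     last row, and with it the whole chain does. *)
  have cn : p.1 < c \/ p.2 < n.
    case: p ep pc pn {h hp s2} => u v /= ep pc pn.
    have [|uc] := leqP c u; last by left.
    move=> cu; have eu : u = c by lia.
    subst u; right; rewrite ltn_neqAle -ltnS pn andbT.
    by apply/eqP => ev; rewrite ev b in ep.
  apply/orP; case: cn => hc; [right; apply/IHc | left; apply/IHn];
    exists (rcons s p); (split; [by rewrite size_rcons ss | by rewrite sorted_rcons_lt2 s1; apply/allP |]);
    move=> q qs; have [q1 q2] := hp q qs; have [? ? ?] := h q qs; split=> //; lia.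
have [yA _ _ /(_ isT) [-> eC]] := cr; rewrite eC rule_one in_fset1U xpair_eqE eqxx /=.
have -> : (k == row_len (growth e c n) 0) || ((0, k) \in growth e c n) =
    (k == 0) || ((0, k.-1) \in growth e c n).
  by rewrite -!mem_row_len //; case: k => [|k] /=; lia.
split.
  case/orP => [/eqP->|].
    exists [:: (c, n)]; split=> // p; rewrite inE => /eqP->; rewrite b; split=> //=; lia.
  case: k => [|k]; rewrite /=.
    move=> _; exists [:: (c, n)]; split=> // p; rewrite inE => /eqP->; rewrite b; split=> //=; lia.
  rewrite -eC => /IHc [s [h1 h2 h3]]; exists (rcons s (c, n)).
  rewrite size_rcons h1; split=> //.
    rewrite sorted_rcons_lt2 h2; apply/allP => p ps; rewrite /lt2 /=.
    have [ep pc pn] := h3 p ps; rewrite pc /= ltn_neqAle -ltnS pn andbT.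
    by apply/eqP => ev; rewrite ev in ep; have := pe.1 _ _ _ ep b; lia.
  move=> p; rewrite mem_rcons inE => /orP[/eqP->|/h3[h4 h5 h6]]; first by rewrite b; split=> /=.
  by split=> //; apply: leqW.
case=> s []; case/lastP: s => [//|s p]; rewrite size_rcons => -[ss].
rewrite sorted_rcons_lt2 => /andP[s1 /allP s2] h.
have [//|k0] := eqVneq k 0; rewrite -eC.
have /h[ep pc pn] : p \in rcons s p by rewrite mem_rcons mem_head.
apply/IHc; exists s; split=> //; first lia.
move=> q qs; have /andP[q1 q2] := s2 q qs.
have /h[? ? ?] : q \in rcons s p by rewrite mem_rcons inE qs orbT.
by split=> //; apply: leq_trans q1 _.
Qed.

Definition pat_lt (a : bool) (p q : nat * nat) : bool :=
  (p.1 < q.1) && (if a then p.2 < q.2 else q.2 < p.2).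

(* [E] contains the filling iota_k (if [a]) or delta_k (otherwise), all cells of
   the occurrence being in [S]. *)
Definition has_pat (a : bool) (k : nat) (S E : {fset nat * nat}) : Prop :=
  exists s, [/\ size s = k, sorted (pat_lt a) s, {subset s <= E}
    & forall p q, p \in s -> q \in s -> (p.1, q.2) \in S].

Definition pfill (E : {fset nat * nat}) : Prop :=
  [/\ forall x y : nat, (x, y) \in E -> 0 < x /\ 0 < y,
      forall x y y' : nat, (x, y) \in E -> (x, y') \in E -> y = y'
    & forall x x' y : nat, (x, y) \in E -> (x', y) \in E -> x = x'].

(* The columns of the matrix are read from left to right, its rows downwards
   starting from row [h] of the filling. *)
Definition mat (E : {fset nat * nat}) (h i j : nat) : bool := (i.+1, h - j) \in E.

Lemma pperm_mat E h : pfill E -> pperm (mat E h).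
Proof.
case=> ps h1 h2; split => [i i' j|i j j'] e1 e2; first by have := h2 _ _ _ e1 e2; lia.
by have [_ ?] := ps _ _ e1; have [_ ?] := ps _ _ e2; have := h1 _ _ _ e1 e2; lia.
Qed.

(* Avoidance read off the shape of a rectangle: no increasing (resp. decreasing)
   chain of [k.+1] cells. *)
Definition okshape (a : bool) (k : nat) (A : diagram) : bool :=
  if a then (k, 0) \notin A else (0, k) \notin A.

Lemma okshape_tr a k A : okshape (~~ a) k (tr A) = okshape a k A.
Proof. by case: a; rewrite /okshape /= mem_tr. Qed.

Lemma okshapeP a k E l h w : pfill E -> l <= h.+1 ->
  (forall x y : nat, (x, y) \in E -> x <= w /\ y <= h) ->
  ~~ okshape a k (growth (mat E h) w (h.+1 - l)) <->
  exists s, [/\ size s = k.+1, sorted (pat_lt a) s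
    & forall p, p \in s -> p \in E /\ l <= p.2].
Proof.
move=> pE lh bE; have pm := pperm_mat h pE; set n := h.+1 - l; have [ps _ _] := pE.
have -> : ~~ okshape a k (growth (mat E h) w n) =
   ((0, k) \in growth (if a then vflip n (mat E h) else mat E h) w n).
  case: (a); rewrite /okshape negbK //.
  by rewrite growth_vflip // mem_tr.
set e := if a then _ else _.
have pe : pperm e by rewrite /e; case: (a) => //; apply: pperm_vflip.
pose f (p : nat * nat) := (p.1.+1, if a then l + p.2 else h - p.2).
pose g (p : nat * nat) := (p.1.-1, if a then p.2 - l else h - p.2).
have eE i j : j < n -> e i j = (f (i, j) \in E).
  rewrite /e /f /n /=; case: (a) => jn //; rewrite /vflip /mat jn /=.
  by congr (_ \in E); congr (_, _); lia.
split=> [/(growth_first_row _ _ _ pe)|] [s [h1 h2 h3]].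
  exists (map f s); rewrite size_map; split=> //.
    rewrite sorted_map; have hs : all (fun p => p.2 < n) s by apply/allP => p /h3[].
    apply: (sub_in_sorted (P := fun p => p.2 < n) _ hs h2).
    move=> p q; rewrite !unfold_in /lt2 /= /pat_lt /n => pn qn /andP[u v].
    by rewrite /= ltnS u /=; case: (a); lia.
  move=> _ /mapP[p /h3[ep pw pn] ->]; move: ep; rewrite eE // -surjective_pairing.
  split=> //; move: pn; rewrite /f /n /=; case: (a); lia.
apply/(growth_first_row _ _ _ pe); exists (map g s); rewrite size_map; split=> //.
  have hs : all (fun p => [&& p \in E & l <= p.2]) s.
    by apply/allP => p /h3[-> ->].
  rewrite sorted_map; apply: (sub_in_sorted _ hs h2).
  move=> [x y] [x' y']; rewrite !unfold_in /= => /andP[/[dup]/ps[? ?] /bE[? ?] ?].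
  move=> /andP[/[dup]/ps[? ?] /bE[? ?] ?]; rewrite /lt2 /pat_lt /=; case: (a); lia.
move=> _ /mapP[[x y] /h3[/= xyE ly] ->]; have [? ?] := ps _ _ xyE.
have [xw yh] := bE _ _ xyE.
have gn : (g (x, y)).2 < n by rewrite /g /n /=; case: (a); lia.
split=> //; last by rewrite /g /=; lia.
rewrite eE // /f /g /=; rewrite (_ : (_, _) = (x, y)) //.
by congr (_, _); [lia | case: (a); lia].
Qed.

Definition restrict (c : nat) (E : {fset nat * nat}) : {fset nat * nat} :=
  [fset p in E | p.1 <= c].

Lemma mem_restrict c E x y : ((x, y) \in restrict c E) = ((x, y) \in E) && (x <= c).
Proof. by rewrite !inE. Qed.

Lemma pfill_sub E E' : pfill E -> {subset E' <= E} -> pfill E'.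
Proof. by case=> h1 h2 h3 s; split=> [x y /s/h1|x y y' /s h /s|x x' y /s h /s] //; eauto. Qed.

Lemma has_pat_sub a k S E E' : {subset E <= E'} -> has_pat a k S E -> has_pat a k S E'.
Proof. by move=> sE [s [h1 h2 h3 h4]]; exists s; split=> // p /h3/sE. Qed.

(** An occurrence using a column beyond [c] meets that column in all its rows, so it lies in rows
    from [l] on. There every pair of 1-cells spans cells of [S], so occurrences are plain chains and
    one diagram decides whether they exist. *)
Lemma has_pat_split a k S E c w l h : pfill E -> l <= h.+1 ->
  (forall x y : nat, (x, y) \in E -> x <= w /\ y <= h) ->
  (forall x y : nat, (x, y) \in S -> c < x -> l <= y) ->
  (forall p q, p \in E -> q \in E -> l <= p.2 -> l <= q.2 -> (p.1, q.2) \in S) ->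
  has_pat a k.+1 S E <->
  has_pat a k.+1 S (restrict c E) \/ ~~ okshape a k (growth (mat E h) w (h.+1 - l)).
Proof.
move=> pE lh bE h2 h3; split.
  move=> [s [s1 s2 s3 s4]].
  have [/allP al|] := boolP (all (fun p => p.1 <= c) s).
    by left; exists s; split=> // -[x y] ps; rewrite mem_restrict s3 //=; apply: (al _ ps).
  rewrite -has_predC => /hasP[[x y] xys /=]; rewrite -ltnNge => cx.
  right; apply/okshapeP => //; exists s; split=> // q qs; split; first exact: s3.
  exact: h2 (s4 _ _ xys qs) cx.
case=> [|/okshapeP]; first by apply: has_pat_sub => -[x y]; rewrite mem_restrict => /andP[].
case=> // s [s1 s2 s3]; exists s; split=> // [p /s3[]//|p q /s3[? ?] /s3[? ?]].
exact: h3.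
Qed.

(** * Partial fillings and their transfer *)

(* [E] fills the columns up to [c] of [S], leaving rows from [l] on possibly
   empty. *)
Definition state (a : bool) (k : nat) (S : {fset nat * nat}) (c l : nat)
    (E : {fset nat * nat}) : Prop :=
  [/\ {subset E <= S}, pfill E,
      (forall x y : nat, (x, y) \in E -> x <= c) /\
      (forall x : nat, 0 < x <= c -> exists y : nat, (x, y) \in E),
      forall y : nat, 0 < y < l -> exists x : nat, (x, y) \in E
    & ~ has_pat a k.+1 S E].

(** Rows are read downwards, so that the lowest active row, the first to be dropped, only affects
    the last diagram. *)
Definition row_tableau (E : {fset nat * nat}) (c l h : nat) : seq diagram :=
  mkseq (growth (mat E h) c) (h.+1 - l).+1.

(* A partial filling avoiding one pattern can be exchanged for one avoiding the
   other, with any prescribed tableau of transposed shape on the active rows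
   [l..h], injectively among the fillings with the same tableau. *)
Definition transferable (a : bool) (k : nat) (S : {fset nat * nat}) (c l h : nat) : Prop :=
  exists F : {fset nat * nat} -> seq diagram -> {fset nat * nat},
  forall E T, state a k S c l E ->
    size T = (h.+1 - l).+1 -> chain (nth fset0 T) (h.+1 - l) ->
    nth fset0 T (h.+1 - l) = tr (growth (mat E h) c (h.+1 - l)) ->
    [/\ state (~~ a) k S c l (F E T), row_tableau (F E T) c l h = T
      & forall E', state a k S c l E' -> row_tableau E' c l h = row_tableau E c l h ->
          F E' T = F E T -> E' = E].

Lemma row_tableauP E c l h T : size T = (h.+1 - l).+1 ->
  row_tableau E c l h = T <->
  forall j, j <= h.+1 - l -> growth (mat E h) c j = nth fset0 T j.
Proof.
move=> sT; split=> [<- j jn|hE]; first by rewrite nth_mkseq.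
apply: (@eq_from_nth _ fset0) => [|j]; rewrite size_mkseq ?sT // => jn.
by rewrite nth_mkseq // hE.
Qed.

Lemma row_tableau_eq E E' c c' l h : row_tableau E c l h = row_tableau E' c' l h <->
  forall j, j <= h.+1 - l -> growth (mat E h) c j = growth (mat E' h) c' j.
Proof.
split=> [/row_tableauP|] h1; last first.
  by apply/row_tableauP; rewrite ?size_mkseq // => j jn; rewrite nth_mkseq // h1.
by move=> j jn; rewrite h1 ?size_mkseq // nth_mkseq.
Qed.

Lemma growth_restrict c E h i j : i <= c ->
  growth (mat (restrict c E) h) i j = growth (mat E h) i j.
Proof.
move=> ic; apply: (growth_ext (c := c) (n := j)) => // i' j' ic' _.
by rewrite /mat mem_restrict ic' andbT.
Qed.

Lemma growth_row_neq e i j : pperm e ->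
  growth e i j.+1 <> growth e i j <-> exists2 i', i' < i & e i' j.
Proof.
move=> pe; rewrite growth_row_eq //; split=> [h|[i' i'i ei'] h]; last first.
  by have := h i' i'i; rewrite ei'.
have [/existsP[i' ei']|] := boolP [exists i' : 'I_i, e i' j]; first by exists i'.
rewrite negb_exists => /forallP h'; case: h => i' i'i; exact: (h' (Ordinal i'i)).
Qed.

Lemma growth_col_neq e i j : pperm e ->
  growth e i.+1 j <> growth e i j <-> exists2 j', j' < j & e i j'.
Proof.
move=> pe; have := growth_row_neq j i (pperm_flip pe).
by rewrite (growth_flip e j i.+1) (growth_flip e j i).
Qed.

Lemma restrict_sub c E : {subset restrict c E <= E}.
Proof. by move=> [x y]; rewrite mem_restrict => /andP[]. Qed.

Lemma state_restrict a k S c c' l E : c' <= c ->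
  (forall x y : nat, (x, y) \in S -> y < l -> x <= c') ->
  state a k S c l E -> state a k S c' l (restrict c' E).
Proof.
move=> cc dn [ES pE [bE cE] rE nE].
have sE := @restrict_sub c' E.
split.
- by move=> p /sE/ES.
- exact: pfill_sub pE sE.
- split=> [x y|x /andP[x0 xc]]; first by rewrite mem_restrict => /andP[].
  have [|y xyE] := cE x; first by rewrite x0 (leq_trans xc).
  by exists y; rewrite mem_restrict xyE.
- move=> y /andP[y0 yl]; have [|x xyE] := rE y; first by rewrite y0.
  by exists x; rewrite mem_restrict xyE (dn _ _ (ES _ xyE)).
- by move=> h; apply: nE; apply: has_pat_sub h.
Qed.

(** From the tableau [T] prescribed at column [c.+1] and the transposed shape of [E] at column [c],
    the inverse rules yield both the tableau to prescribe at column [c] and the row of the new 1. *)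
Lemma transfer_add_column a k S c l x0 h :
  (forall x y : nat, (x, y) \in S -> 0 < x /\ 0 < y) ->
  (forall x y : nat, x <= c.+1 -> l <= y -> ((x, y) \in S) = (x0 <= x) && (y <= h)) ->
  (forall x y : nat, (x, y) \in S -> y < l -> x <= c) ->
  x0 <= c.+1 -> 0 < l <= h ->
  transferable a k S c l h -> transferable a k S c.+1 l h.
Proof.
move=> pS rect done xc /andP[l0 lh] [F HF]; set n := h.+1 - l in HF.
have en : h.+1 - l = n by [].
have n0 : 0 < n by rewrite /n; lia.
have colP x y : (x, y) \in S -> c < x -> l <= y.
  by move=> xyS cx; rewrite leqNgt; apply/negP => /(done _ _ xyS); lia.
have bS x y : (x, y) \in S -> l <= y -> x <= c.+1 -> y <= h.
  by move=> xyS ly xc'; move: xyS; rewrite rect // => /andP[].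
pose A E := growth (mat E h) c n.
pose B E T := unbit (nth fset0 T) (tr (A E)) n.
pose fT E T := mkseq (uncol (nth fset0 T) (tr (A E)) n) n.+1.
pose N E T : {fset nat * nat} := [fset (c.+1, h - j) | j in iota 0 n & B E T j].
exists (fun E T => F (restrict c E) (fT E T) `|` N E T) => E T stE; rewrite en => sT cT eT.
have memN E' T' x y : ((x, y) \in N E' T') = [&& x == c.+1, l <= y, y <= h & B E' T' (h - y)].
  apply/imfsetP/idP => [[j /=]|/and4P[/eqP-> ly yh b]].
    rewrite inE mem_iota /= add0n => /andP[jn b] [-> ->].
    by rewrite eqxx /= subKn ?b; move: jn; rewrite /n; lia.
  exists (h - y); last by rewrite subKn.
  by rewrite /= inE mem_iota b andbT /n; lia.
have stR E' : state a k S c.+1 l E' -> state a k S c l (restrict c E').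
  exact: state_restrict (leqnSn c) done.
have bE' E' : state a k S c.+1 l E' -> forall x y : nat, (x, y) \in E' -> x <= c.+1 /\ y <= h.
  case=> ES _ [bE _] _ _ x y xyE; have xc' := bE _ _ xyE; split=> //.
  by have [ly|] := leqP l y; [apply: bS (ES _ xyE) ly xc' | lia].
have crossS E' : state a k S c.+1 l E' -> forall p q, p \in E' -> q \in E' ->
    l <= p.2 -> l <= q.2 -> (p.1, q.2) \in S.
  move=> stE' [x y] [x' y'] pE qE /= ly ly'; have [x1 _] := bE' _ stE' _ _ pE.
  have [x2 y2] := bE' _ stE' _ _ qE; have [ES _ _ _ _] := stE'.
  by have := ES _ pE; rewrite !rect // => /andP[-> _].
have [ES pE [bE cE] rE nE] := stE.
have pm := pperm_mat h pE.
have yA : young (tr (A E)) by apply/young_tr/growth_young.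
have sA : step (tr (A E)) (nth fset0 T n).
  by rewrite eT; apply: step_tr; have [] := growth_corner c n pm.
have [cL hL uL _] := uncolP cT yA sA.
have sfT : size (fT E T) = n.+1 by rewrite size_mkseq.
have nfT j : j <= n -> nth fset0 (fT E T) j = uncol (nth fset0 T) (tr (A E)) n j.
  by move=> jn; rewrite nth_mkseq.
have [||stF tF iF] := HF (restrict c E) (fT E T) (stR _ stE) sfT.
- split=> [|j jn]; first by rewrite nfT // cL.1.
  by rewrite (nfT _ jn) (nfT _ (ltnW jn)); apply: cL.2.
- by rewrite nfT // uncol_last growth_restrict.
set E2 := F _ _ in stF tF iF *; set E3 := E2 `|` _.
have [E2S pE2 [bE2 cE2] rE2 nE2] := stF.
have rE3 : restrict c E3 = E2.
  apply/fsetP => -[x y]; rewrite mem_restrict in_fsetU memN.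
  have [xc'|] := leqP x c; first by rewrite ltn_eqF // orbF andbT.
  by move=> cx; rewrite andbF; apply/esym/negP => /bE2; lia.
have m3 j : j < n -> mat E3 h c j = B E T j.
  move=> jn; rewrite /mat in_fsetU memN eqxx /=.
  have -> : ((c.+1, h - j) \in E2) = false by apply/negP => /bE2; lia.
  have -> : h - (h - j) = j by move: jn; rewrite /n; lia.
  by move: jn; rewrite /n; lia.
have g3 j : j <= n -> growth (mat E3 h) c j = uncol (nth fset0 T) (tr (A E)) n j.
  move=> jn; rewrite -(growth_restrict E3 h j (leqnn c)) rE3 -nfT //.
  by move/row_tableauP: tF; apply.
have g3' j : j <= n -> growth (mat E3 h) c.+1 j = nth fset0 T j.
  elim: j => [|j IHj] jn; first by rewrite growth0r cT.1.
  by rewrite growthS IHj 1?ltnW // !g3 ?m3 // 1?ltnW //; have [_ ->] := hL j jn.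
(* The corner condition at the new 1 makes the step of column [c] trivial there, so the row carries
   no earlier 1. *)
have N2 x y : (c.+1, y) \in N E T -> (x, y) \notin E2.
  rewrite memN eqxx /= => /and3P[ly yh b]; apply/negP => xyE2.
  have jn : h - y < n by rewrite /n; lia.
  have [[_ _ _ /(_ b)[_]]] := hL _ jn.
  rewrite -!g3 // 1?ltnW // -!(growth_restrict E3 h _ (leqnn c)) rE3 => e1 _.
  have /(growth_row_eq c (h - y) (pperm_mat h pE2)) := e1.
  have [x0' y0'] : 0 < x /\ 0 < y by have [h1 _ _] := pE2; apply: h1 xyE2.
  move=> /(_ x.-1); rewrite /mat subKn // prednK // xyE2 => /(_ _)/negP; apply=> //.
  by have := bE2 _ _ xyE2; lia.
have memN' x y : (x, y) \in N E T -> x = c.+1 /\ l <= y <= h.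
  by rewrite memN => /and4P[/eqP-> -> ->].
have pE3 : pfill E3.
  have [p1 p2 p3] := pE2; split=> [x y|x y y'|x x' y]; rewrite !in_fsetU.
  - by case/orP => [/p1|/memN'] //; lia.
  - case/orP => [e1|e1] /orP[e2|e2]; first exact: p2 e1 e2.
    + by have [? _] := memN' _ _ e2; have := bE2 _ _ e1; lia.
    + by have [? _] := memN' _ _ e1; have := bE2 _ _ e2; lia.
    + move: e1 e2; rewrite !memN => /and4P[_ ly yh b] /and4P[_ ly' yh' b'].
      by have := uL _ _ b b'; lia.
  - case/orP => [e1|e1] /orP[e2|e2]; first exact: p3 e1 e2.
    + have [ex _] := memN' _ _ e2; rewrite ex in e2.
      by rewrite (negbTE (N2 x y e2)) in e1.
    + have [ex _] := memN' _ _ e1; rewrite ex in e1.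
      by rewrite (negbTE (N2 x' y e1)) in e2.
    + by have [-> _] := memN' _ _ e1; have [-> _] := memN' _ _ e2.
have ES3 : {subset E3 <= S}.
  move=> [x y]; rewrite in_fsetU => /orP[/E2S //|/memN'[-> /andP[ly yh]]].
  by rewrite rect ?xc.
(* Column [c.+1] of [E] is occupied, so the shapes at [c] and [c.+1] differ. Their transposes differ
   too, which forces a 1 in the new column. *)
have [j jn bj] : exists2 j, j < n & B E T j.
  have [|y] := cE c.+1; first by rewrite leqnn.
  move=> cyE; have ly : l <= y by apply: colP (ES _ cyE) _.
  have [_ yh] := bE' _ stE _ _ cyE.
  have : growth (mat E3 h) c.+1 n <> growth (mat E3 h) c n.
    rewrite g3' // g3 // uncol_last eT => /(can_inj trK).
    apply/growth_col_neq => //; exists (h - y); first by rewrite /n; lia.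
    by rewrite /mat subKn.
  move/growth_col_neq => [|j jn bj]; first exact: pperm_mat.
  by exists j => //; rewrite -m3.
have st3 : state (~~ a) k S c.+1 l E3.
  split=> //.
  - split=> [x y|x]; first by rewrite in_fsetU => /orP[/bE2|/memN'[->]] //; lia.
    case/andP => x0' ; rewrite leq_eqVlt ltnS => /orP[/eqP->|xc'].
      exists (h - j); rewrite in_fsetU memN eqxx /=; apply/orP; right.
      have -> : h - (h - j) = j by move: jn; rewrite /n; lia.
      by rewrite bj; move: jn; rewrite /n; lia.
    by have [|y xyE] := cE2 x; [rewrite x0' | exists y; rewrite in_fsetU xyE].
  - by move=> y /rE2[x xyE]; exists x; rewrite in_fsetU xyE.
  - have bE3 x y : (x, y) \in E3 -> x <= c.+1 /\ y <= h.
      rewrite in_fsetU => /orP[xyE|/memN'[->]]; last lia.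
      have xc' := bE2 _ _ xyE; split; first lia.
      by have [ly|] := leqP l y; [apply: bS (E2S _ xyE) ly _; lia | lia].
    have cr3 p q : p \in E3 -> q \in E3 -> l <= p.2 -> l <= q.2 -> (p.1, q.2) \in S.
      case: p q => x y [x' y'] pE3' qE3 /= ly ly'.
      have [x1 _] := bE3 _ _ pE3'; have [x2 y2] := bE3 _ _ qE3.
      by have := ES3 _ pE3'; rewrite !rect // => /andP[-> _].
    have lh' : l <= h.+1 by lia.
    move/(has_pat_split _ _ pE3 lh' bE3 colP cr3) => [|]; first by rewrite rE3.
    rewrite en g3' // eT okshape_tr => nok; apply: nE.
    by apply/(has_pat_split _ _ pE lh' (bE' _ stE) colP (crossS _ stE)); right.
split=> //; first by apply/row_tableauP.
move=> E' stE' /row_tableau_eq; rewrite en => tE eF.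
have [ES' pE' [bE'' _] _ _] := stE'; have pm' := pperm_mat h pE'.
have yA' : young (tr (A E')) by apply/young_tr/growth_young.
have sA' : step (tr (A E')) (nth fset0 T n).
  by rewrite eT -tE //; apply: step_tr; have [] := growth_corner c n pm'.
have [cL' _ _ _] := uncolP cT yA' sA'.
have sfT' : size (fT E' T) = n.+1 by rewrite size_mkseq.
have nfT' j' : j' <= n -> nth fset0 (fT E' T) j' = uncol (nth fset0 T) (tr (A E')) n j'.
  by move=> jn'; rewrite nth_mkseq.
have [||stF' tF' _] := HF (restrict c E') (fT E' T) (stR _ stE') sfT'.
- split=> [|j' jn']; first by rewrite nfT' // cL'.1.
  by rewrite (nfT' _ jn') (nfT' _ (ltnW jn')); apply: cL'.2.
- by rewrite nfT' // uncol_last growth_restrict.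
have eE2 : F (restrict c E') (fT E' T) = E2.
  rewrite -rE3 -eF; apply/fsetP => -[x y]; rewrite mem_restrict in_fsetU memN.
  have [_ _ [bE2' _] _ _] := stF'.
  have [xc'|] := leqP x c; first by rewrite [x == _]ltn_eqF // orbF andbT.
  by move=> cx; rewrite andbF; apply/negP => /bE2'; lia.
(* The tableau of the common image at column [c] ends in the transpose of the shape of either
   preimage, so this shape is remembered. *)
have eA : A E' = A E.
  apply: (can_inj trK).
  have := nfT n (leqnn n); have := nfT' n (leqnn n); rewrite !uncol_last => <- <-.
  move/row_tableauP: tF; move/row_tableauP: tF'; rewrite eE2 => h1 h2.
  by rewrite -h1 // -h2.
have [h1 h2] := @uncol_uniq (growth (mat E h) c.+1) (A E) n (growth (mat E h) c) (mat E h c)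
  erefl (fun j _ => conj (growth_corner c j pm) (esym (growthS (mat E h) c j))).
have [||h1' h2'] := @uncol_uniq (growth (mat E h) c.+1) (A E) n (growth (mat E' h) c) (mat E' h c).
- by rewrite -eA.
- move=> j' jn'; rewrite -!tE //; last exact: ltnW.
  by split=> //; apply: growth_corner.
have eR : restrict c E' = restrict c E.
  apply: iF; first exact: stR.
    apply/row_tableau_eq => j' jn'; rewrite !growth_restrict // h1 // h1' //.
  by rewrite -/E2 -eE2 /fT eA.
apply/fsetP => -[x y]; have [xc'|cx] := leqP x c.
  by move/fsetP/(_ (x, y)): eR; rewrite !mem_restrict xc' !andbT.
have H E0 : state a k S c.+1 l E0 ->
    ((x, y) \in E0) = [&& x == c.+1, l <= y, y <= h & mat E0 h c (h - y)].
  move=> st0; have [E0S _ _ _ _] := st0; apply/idP/and4P => [xyE|[/eqP-> ly yh]].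
    have [xc' yh] := bE' _ st0 _ _ xyE; have ly := colP _ _ (E0S _ xyE) cx.
    have ex : x = c.+1 by lia.
    by split=> //; [apply/eqP | rewrite /mat subKn // -ex].
  by rewrite /mat subKn.
rewrite !H //; case: eqP => //= _; case ly : (l <= y) => //=; case yh : (y <= h) => //=.
by rewrite h2 ?h2' // /n; lia.
Qed.

(** Dropping row [l] truncates the tableau. The prescribed one is prolonged by the transposed shape
    of [E]; the extra step is nontrivial because row [l] of [E] is occupied, so row [l] of the image
    is occupied as well. *)
Lemma transfer_drop_row a k S c l h :
  (forall x y : nat, (x, y) \in S -> 0 < x /\ 0 < y) ->
  (forall x : nat, (x, l) \in S -> x <= c) -> 0 < l <= h ->
  transferable a k S c l h -> transferable a k S c l.+1 h.
Proof.
move=> pS dn /andP[l0 lh] [F HF].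
have en : h.+1 - l = (h.+1 - l.+1).+1 by lia.
set n := h.+1 - l.+1 in en; rewrite en in HF.
exists (fun E T => F E (rcons T (tr (growth (mat E h) c n.+1)))) => E T stE sT cT eT.
have stS E' : state a k S c l.+1 E' -> state a k S c l E'.
  case=> ES pE bE rE nE; split=> // y /andP[y0 yl]; apply: rE; lia.
have [ES pE [bE cE] rE nE] := stE; have pm := pperm_mat h pE.
set L := tr _; pose T1 := rcons T L.
have nT1 j : nth fset0 T1 j = if j <= n then nth fset0 T j else if j == n.+1 then L else fset0.
  by rewrite nth_rcons sT ltnS.
have [|||stF tF iF] := HF E T1 (stS _ stE).
- by rewrite size_rcons sT.
- split=> [|j jn]; first by rewrite nT1 cT.1.
  rewrite !nT1; have [->|nj] := eqVneq j n.
    rewrite leqnn ltnn eqxx eT; apply: step_tr.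
    by have [] := growth_corner c n pm.
  have [jn' jn''] : j < n /\ j <= n by lia.
  by rewrite jn' jn''; apply: cT.2.
- by rewrite nT1 ltnn eqxx.
have hT j : j <= n.+1 -> growth (mat (F E T1) h) c j = nth fset0 T1 j.
  by rewrite -en; move/row_tableauP: tF; apply; rewrite size_rcons sT en.
have [E2S pE2 bE2 rE2 nE2] := stF.
split.
- split=> // y /andP[y0]; rewrite ltnS leq_eqVlt => /orP[/eqP->|yl]; last by apply: rE2; rewrite y0.
  have [|x xlE] := rE l; first by rewrite l0 leqnn.
  have hn : h - n = l by rewrite /n; lia.
  have : growth (mat (F E T1) h) c n.+1 <> growth (mat (F E T1) h) c n.
    rewrite !hT // !nT1 leqnn ltnn eqxx eT => /(can_inj trK).
    apply/growth_row_neq => //; exists x.-1.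
      by have [? _] := pS _ _ (ES _ xlE); have := dn _ (ES _ xlE); lia.
    by rewrite /mat hn prednK //; have [] := pS _ _ (ES _ xlE).
  move/growth_row_neq => [|i _ iE]; first exact: pperm_mat.
  by exists i.+1; rewrite -hn.
- apply/row_tableauP => // j jn; rewrite hT ?nT1 ?jn //; exact: leqW.
- move=> E' stE' /row_tableau_eq tE eF.
  have [ES' pE' _ _ _] := stE'; have pm' := pperm_mat h pE'.
  pose T1' := rcons T (tr (growth (mat E' h) c n.+1)).
  have nT1' j : nth fset0 T1' j = if j <= n then nth fset0 T j
       else if j == n.+1 then tr (growth (mat E' h) c n.+1) else fset0.
    by rewrite nth_rcons sT ltnS.
  have [|||stF' tF' _] := HF E' T1' (stS _ stE').
  + by rewrite size_rcons sT.
  + split=> [|j jn]; first by rewrite nT1' cT.1.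
    rewrite !nT1'; have [->|nj] := eqVneq j n.
      rewrite leqnn ltnn eqxx eT -tE //; apply: step_tr.
      by have [] := growth_corner c n pm'.
    have [jn' jn''] : j < n /\ j <= n by lia.
    by rewrite jn' jn''; apply: cT.2.
  + by rewrite nT1' ltnn eqxx.
  have eT1 : T1' = T1 by rewrite -[RHS]tF -[LHS]tF'; congr (row_tableau _ c l h).
  apply: iF; [exact: stS | | by rewrite -{1}eT1; exact: eF].
  apply/row_tableau_eq => j; rewrite en leq_eqVlt => /orP[/eqP->|]; last exact: tE.
  apply: (can_inj trK); have := congr1 (fun T => nth fset0 T n.+1) eT1.
  by rewrite nT1 nT1' ltnn eqxx.
Qed.

(** When no filled column meets the active rows, all diagrams are empty whatever the top row is, so
    a new rectangle may start with any height. *)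
Lemma transfer_empty a k S c l h h' :
  (forall x y : nat, (x, y) \in S -> 0 < x /\ 0 < y) ->
  (forall x y : nat, x <= c -> l <= y -> (x, y) \notin S) -> 0 < l ->
  transferable a k S c l h -> transferable a k S c l h'.
Proof.
move=> pS emp l0 [F HF].
have g0 b E h0 j : state b k S c l E -> j <= h0.+1 - l -> growth (mat E h0) c j = fset0.
  case=> ES pE _ _ _ jn; have pm := pperm_mat h0 pE.
  elim: j jn => [|j IHj] jn; first by rewrite growth0r.
  rewrite -IHj 1?ltnW //; apply/growth_row_eq => // i ic.
  by apply/negP => /ES; apply/negP/emp => //; lia.
exists (fun E T => F E (nseq (h.+1 - l).+1 fset0)) => E T stE sT cT eT.
have nz j : nth fset0 (nseq (h.+1 - l).+1 (fset0 : diagram)) j = fset0.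
  by rewrite nth_nseq if_same.
have [||stF tF iF] := HF E _ stE (size_nseq (h.+1 - l).+1 (fset0 : diagram)).
- by split=> [|j jn]; rewrite !nz //; apply: step_refl.
- by rewrite nz (g0 a) // tr0.
split=> //.
  apply/row_tableauP => // j jn; rewrite (g0 (~~ a)) //.
  have mono m : m <= h'.+1 - l -> nth fset0 T (h'.+1 - l - m) = fset0.
    elim: m => [|m IHm] mn; first by rewrite subn0 eT (g0 a) // tr0.
    have := cT.2 (h'.+1 - l - m.+1) ltac:(lia).
    rewrite (_ : (h'.+1 - l - m.+1).+1 = h'.+1 - l - m); last lia.
    rewrite IHm; last lia.
    by case=> [//|[x _ /fsetP/(_ x)]]; rewrite in_fset1U eqxx inE.
  by have := mono _ (leq_subr j _); rewrite subKn.
move=> E' stE' _ eF; apply: iF => //; apply/row_tableau_eq => j jn.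
by rewrite !(g0 a).
Qed.

(** * Turning at a rectangle *)

Lemma growth_empty e c n : (forall i j, i < c -> j < n -> ~~ e i j) ->
  forall i j, i <= c -> j <= n -> growth e i j = fset0.
Proof.
move=> h; elim=> [//|i IHi] j ic; elim: j => [|j IHj] jn; first by rewrite growth0r.
have [jn' ic'] : j <= n /\ i <= c by lia.
rewrite growthS IHj // !IHi // (negbTE (h i j ic jn)).
by rewrite rule_nonel //; apply: step_refl.
Qed.

(** After transposition [mat] starts from the bottom right corner of [E]. This is a half-turn of the
    matrix with its axes exchanged, and [growth_flip] undoes the exchange. Rows below [l] are empty
    in the columns beyond [c] and contribute nothing. *)
Lemma growth_turn E c l h w : 0 < l <= h.+1 -> c <= w ->
  (forall x y : nat, (x, y) \in E -> c < x -> l <= y) ->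
  forall j, j <= w - c ->
  growth (mat (tr E) w) h j = growth (vflip (h.+1 - l) (hflip w (mat E h))) j (h.+1 - l).
Proof.
move=> /andP[l0 lh] cw bE j jw; set n := h.+1 - l.
set R := vflip n _; rewrite -(growth_flip R n j).
have -> : h = l.-1 + n by rewrite /n; lia.
have := @growth_shift (mat (tr E) w) (fun a b => R b a) l.-1 0 n j.
rewrite -[X in _ = growth _ X _]add0n; apply=> // [j' jj'|i j' id jj'].
  apply: (growth_empty (c := l.-1) (n := j)) => // i j1 il j1j.
  by rewrite /mat mem_tr; apply/negP => /bE; lia.
rewrite /R /vflip /hflip /mat mem_tr id add0n.
have -> : j' < w by lia.
by rewrite /=; congr (_ \in E); congr (_, _); rewrite /n; lia.
Qed.

Lemma rev_map_swap_mem (s : seq (nat * nat)) p :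
  (p \in map (fun q => (q.2, q.1)) s) = ((p.2, p.1) \in s).
Proof.
by apply/mapP/idP => [[q qs ->]|ps]; [rewrite -surjective_pairing | exists (p.2, p.1) => //; case: p ps].
Qed.

(** Both diagonal fillings are symmetric; a decreasing chain merely has to be listed backwards. *)
Lemma has_pat_trW a k S E : has_pat a k S E -> has_pat a k (tr S) (tr E).
Proof.
move=> [s [s1 s2 s3 s4]]; pose sw (q : nat * nat) := (q.2, q.1).
exists (if a then map sw s else rev (map sw s)).
have m p : (p \in (if a then map sw s else rev (map sw s))) = (sw p \in s).
  by case: (a); rewrite ?mem_rev rev_map_swap_mem.
split=> [||[x y]|[x y] [x' y']]; rewrite ?m.
- by case: (a); rewrite ?size_rev size_map.
- case: (a) s2 => s2; rewrite ?rev_sorted sorted_map; apply: sub_sorted s2 => p q;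
    by rewrite /pat_lt /= andbC.
- by rewrite mem_tr => /s3.
- by rewrite mem_tr => ps qs; apply: s4 qs ps.
Qed.

Lemma has_pat_tr a k S E : has_pat a k (tr S) (tr E) <-> has_pat a k S E.
Proof.
by split=> [/has_pat_trW|]; [rewrite !trK | apply: has_pat_trW].
Qed.

Lemma pfill_tr E : pfill E -> pfill (tr E).
Proof.
case=> h1 h2 h3; split=> [x y|x y y'|x x' y]; rewrite !mem_tr; first by case/h1.
  exact: h3.
exact: h2.
Qed.

(** The chain depends on the final diagram alone and not on how it was reached; this lets an image
    determine it later. Diagrams at the end of no chain receive a junk value. *)
Lemma chain_selector : exists Q : diagram -> seq diagram, forall R n,
  chain R n -> chain (nth fset0 (Q (R n))) (size (Q (R n))).-1 /\
    nth fset0 (Q (R n)) (size (Q (R n))).-1 = R n.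
Proof.
pose P (A : diagram) (T : seq diagram) := forall R n, chain R n -> R n = A ->
  chain (nth fset0 T) (size T).-1 /\ nth fset0 T (size T).-1 = A.
have /boolp.choice[Q HQ] : forall A, exists T, P A T.
  move=> A.
  have [[R [n [cR RA]]]|nR] := boolp.EM (exists R n, chain R n /\ R n = A); last first.
    by exists [::] => R n cR RA; case: nR; exists R, n.
  exists (mkseq R n.+1) => _ _ _ _; rewrite size_mkseq /= nth_mkseq //; split=> //.
  by split=> [|j jn]; rewrite !nth_mkseq ?cR.1 // 1?ltnW //; apply: cR.2.
by exists Q => R n cR; apply: HQ cR erefl.
Qed.

Definition glue (c : nat) (e e' : nat -> nat -> bool) i j :=
  if i < c then e i j else e' (i - c) j.

Lemma pperm_glue c e e' : pperm e -> pperm e' ->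
  (forall i i' j, i < c -> e i j -> ~~ e' i' j) -> pperm (glue c e e').
Proof.
move=> [p1 p2] [q1 q2] h; rewrite /glue; split=> [i i' j|i j j'].
  case: ifP => ic; case: ifP => ic' h1 h2.
  - exact: p1 h1 h2.
  - by have := h _ (i' - c) _ ic h1; rewrite h2.
  - by have := h _ (i - c) _ ic' h2; rewrite h1.
  - by have := q1 _ _ _ h1 h2; lia.
by case: ifP => ic; [apply: p2 | apply: q2].
Qed.

Lemma vflipK n e i j : j < n -> vflip n (vflip n e) i j = e i j.
Proof.
move=> jn; rewrite /vflip jn /=; have -> : n - j.+1 < n by lia.
by congr (e _ _); lia.
Qed.

Lemma growth_rows e e' c m n : pperm e -> pperm e' ->
  (forall j, j <= n -> growth e c j = growth e' m j) ->
  forall j, j < n -> (exists2 i, i < c & e i j) <-> (exists2 i, i < m & e' i j).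
Proof.
move=> pe pe' h j jn; rewrite -(growth_row_neq c j pe) -(growth_row_neq m j pe').
by rewrite (h _ jn) (h _ (ltnW jn)).
Qed.

(* Columns beyond [c] meet the active rows [l..h] in a full rectangle with last
   column [w].  Its filling [N] is reflected vertically and then replaced by the
   filling with the same tableau along its left border and the prescribed one
   along its top border, both read from the bottom right corner; hence the shape
   of the whole rectangle is transposed.  The tableau on the filled columns is
   replaced by that of the reflection of some permutation; fixing the recording
   tableau [Q] of this permutation makes the replacement injective. *)
Lemma transfer_turn a k S c l x0 h w :
  (forall x y : nat, (x, y) \in S -> 0 < x /\ 0 < y) ->
  (forall x y : nat, x <= c -> l <= y -> ((x, y) \in S) = (x0 <= x) && (y <= h)) ->
  (forall x y : nat, c < x -> y <= h -> ((x, y) \in S) = (l <= y) && (x <= w)) ->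
  0 < l <= h -> c <= w ->
  transferable a k S c l h -> transferable a k (tr S) h c.+1 w.
Proof.
move=> pS rect1 rect2 /andP[l0 lh] cw [F HF].
have lh' : l <= h.+1 by lia.
pose n := h.+1 - l; have en : h.+1 - l = n by [].
pose d := w - c; have ed : w.+1 - c.+1 = d by [].
have ew : c + d = w by rewrite /d; lia.
have [Q HQ] := chain_selector.
pose A0 E := growth (mat E h) c n.
pose m E := (size (Q (A0 E))).-1.
(* The stand-in for the left part: it has the same tableau on the active rows, but [m E] columns
   instead of [c], as many as the selected chain has steps. *)
pose w0 E := unrsk (m E) n (growth (mat E h) c) (nth fset0 (Q (A0 E))).
pose T0 E := mkseq (growth (vflip n (w0 E)) (m E)) n.+1.
pose H E := hflip w (mat E h).
pose R E := vflip n (H E).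
pose n2 E T := unrsk d n (growth (H E) d) (nth fset0 T).
pose N E T : {fset nat * nat} :=
  [fset ((w - b, l + j) : nat * nat) | b in iota 0 d, j in filter (n2 E T b) (iota 0 n)].
have memN E T x y : ((x, y) \in N E T) =
    [&& c < x, x <= w, l <= y, y <= h & n2 E T (w - x) (y - l)].
  apply/imfset2P/and5P => [[b]|[cx xw ly yh b]].
    rewrite /= mem_iota add0n => /andP[_ bd] [j].
    rewrite /= mem_filter mem_iota add0n => /and3P[b2 _ jn] [-> ->].
    have -> : w - (w - b) = b by move: bd; rewrite /d; lia.
    have -> : l + j - l = j by lia.
    by rewrite b2; move: bd jn; rewrite /d /n; split; lia.
  exists (w - x); first by rewrite /= mem_iota /d; lia.
  exists (y - l); first by rewrite /= mem_filter b mem_iota /n; lia.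
  by rewrite subKn // subnKC.
have stE X : state a k (tr S) h c.+1 X ->
  [/\ pfill (tr X) /\ {subset tr X <= S}, state a k S c l (restrict c (tr X)),
     forall x y : nat, (x, y) \in tr X -> x <= w /\ y <= h,
     forall x y : nat, (x, y) \in tr X -> c < x -> l <= y
   & forall y : nat, 0 < y <= h -> exists x : nat, (x, y) \in tr X].
  case=> XS pX [bX cX] rX nX; have ES : {subset tr X <= S}.
    by move=> [x y]; rewrite mem_tr => /XS; rewrite mem_tr.
  have pE := pfill_tr pX.
  have cE y : 0 < y <= h -> exists x : nat, (x, y) \in tr X.
    by move=> /cX[x xy]; exists x; rewrite mem_tr.
  have bE x y : (x, y) \in tr X -> x <= w /\ y <= h.
    move=> /[dup]/ES xyS; rewrite mem_tr => /bX yh; split=> //.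
    have [|cx] := leqP x c; first lia.
    by move: xyS; rewrite rect2 // => /andP[].
  have lE x y : (x, y) \in tr X -> c < x -> l <= y.
    by move=> /[dup]/bE[_ yh] /ES xyS cx; move: xyS; rewrite rect2 // => /andP[].
  split=> //; split.
  - by move=> p /restrict_sub/ES.
  - by apply: pfill_sub pE _; apply: restrict_sub.
  - split=> [x y|x /andP[x1 xc]]; first by rewrite mem_restrict => /andP[].
    have [|y xy] := rX x; first by rewrite x1.
    by exists y; rewrite mem_restrict mem_tr xy.
  - move=> y /andP[y0 yl]; have [|x xy] := cE y; first by lia.
    exists x; rewrite mem_restrict xy /= leqNgt; apply/negP => /(lE _ _ xy); lia.
  - move=> hp; apply: nX; rewrite -[X]trK; apply/has_pat_tr.
    by apply: has_pat_sub hp; apply: restrict_sub.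
have crossS (E : {fset nat * nat}) : {subset E <= S} -> (forall x y : nat, (x, y) \in E -> x <= w /\ y <= h) ->
    forall p q, p \in E -> q \in E -> l <= p.2 -> l <= q.2 -> (p.1, q.2) \in S.
  move=> ES bE [x y] [x' y'] /= pE qE ly ly'; have [xw yh] := bE _ _ pE.
  have [xw' yh'] := bE _ _ qE; have pS' := ES _ pE.
  have [xc|cx] := leqP x c; last by rewrite rect2 // ly' xw.
  by rewrite rect1 // yh' andbT; move: pS'; rewrite rect1 // => /andP[].
have colS x y : (x, y) \in S -> c < x -> l <= y.
  move=> xyS cx; have [yh|] := leqP y h; last lia.
  by move: xyS; rewrite rect2 // => /andP[].
pose out X T := F (restrict c (tr X)) (T0 (tr X)) `|` N (tr X) T.
exists (fun X T => tr (out X T)).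
have main X T : state a k (tr S) h c.+1 X ->
  size T = d.+1 -> chain (nth fset0 T) d ->
  nth fset0 T d = tr (growth (mat X w) h d) -> let E := tr X in let E3 := out X T in
  [/\ [/\ state (~~ a) k S c l (F (restrict c E) (T0 E)),
          row_tableau (F (restrict c E) (T0 E)) c l h = T0 E
        & forall E', state a k S c l E' -> row_tableau E' c l h = row_tableau (restrict c E) c l h ->
            F E' (T0 E) = F (restrict c E) (T0 E) -> E' = restrict c E],
      restrict c E3 = F (restrict c E) (T0 E),
      state (~~ a) k (tr S) h c.+1 (tr E3) /\ row_tableau (tr E3) h c.+1 w = T,
      (forall j, j <= n -> growth (R E3) d j = growth (H E) d j)
    & (forall i, i <= m E -> growth (w0 E) i n = nth fset0 (Q (A0 E)) i) /\
      (pperm (w0 E) /\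
       forall j, j <= n -> growth (w0 E) (m E) j = growth (mat E h) c j)].
  move=> stX sT cT eT E E3.
  have [[pE ES] stE1 bE lE rE] := stE X stX.
  have pm := pperm_mat h pE; have pH := pperm_hflip w pm.
  have cG := chain_growth_col c n pm.
  have [cQ eQ] := HQ _ _ cG.
  have [pw w0b w0c w0r] := unrskP cG cQ (esym eQ).
  rewrite -/(A0 E) -/(m E) -/(w0 E) in cQ eQ pw w0b w0c w0r.
  have pvw := pperm_vflip n pw.
  have nT0 j : j <= n -> nth fset0 (T0 E) j = growth (vflip n (w0 E)) (m E) j.
    by move=> jn; rewrite nth_mkseq.
  have sT0 : size (T0 E) = n.+1 by rewrite size_mkseq.
  have [||st2 tab2 iF] := HF (restrict c E) (T0 E) stE1 sT0.
  - split=> [|j jn]; first by rewrite nT0 // growth0r.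
    rewrite (nT0 _ jn) (nT0 _ (ltnW jn)).
    by have [] := growth_corner (m E) j pvw.
  - by rewrite nT0 // growth_vflip // w0c // growth_restrict.
  rewrite {}/E3 /out -/E; set E2 := F _ _ in st2 tab2 iF *; set E3 := E2 `|` N E T.
  have [E2S pE2 [bE2 cE2] rE2 nE2] := st2.
  have pm2 := pperm_mat h pE2.
  have t2 j : j <= n -> growth (mat E2 h) c j = growth (vflip n (w0 E)) (m E) j.
    by move=> jn; rewrite -nT0 //; move/row_tableauP: tab2; apply.
  have eXE : X = tr E by rewrite trK.
  have eT' : growth (H E) d n = nth fset0 T d.
    by rewrite eT eXE (growth_turn (c := c) (l := l)) ?l0 // growth_vflip // trK.
  have [pn2 n2b n2c n2r] := unrskP (chain_growth_col d n pH) cT eT'.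
  rewrite -/(n2 E T) in pn2 n2b n2c n2r.
  have memN' x y : (x, y) \in N E T -> [/\ c < x, x <= w, l <= y & y <= h].
    by rewrite memN => /and5P[].
  have rE3 : restrict c E3 = E2.
    apply/fsetP => -[x y]; rewrite mem_restrict in_fsetU.
    have [xc|cx] := leqP x c; last by rewrite andbF; apply/esym/negP => /bE2; lia.
    by rewrite andbT orb_idr // => /memN'[]; lia.
  have R3 b j : b < d -> j < n -> R E3 b j = n2 E T b j.
    move=> bd jn; rewrite /R /H /vflip /hflip /mat jn in_fsetU memN.
    have -> : (((w - b.+1).+1, h - (n - j.+1)) \in E2) = false.
      by apply/negP => /bE2; move: bd; rewrite /d; lia.
    have -> : w - (w - b.+1).+1 = b by move: bd; rewrite /d; lia.
    have -> : h - (n - j.+1) - l = j by move: jn; rewrite /n; lia.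
    by case: (n2 _ _ _ _); move: bd jn; rewrite /d /n; lia.
  have g3 b j : b <= d -> j <= n -> growth (R E3) b j = growth (n2 E T) b j.
    exact: growth_ext.
  (* Equal tableaux occupy equal rows, so the new left part uses the mirror images, under [y] to
     [l + h - y], of the rows used by the old one. [rN] says the same of the right part, hence the
     two new parts share no row. *)
  have r2 x y : (x, y) \in E2 -> l <= y <= h ->
      exists x' : nat, (x', l + h - y) \in E /\ x' <= c.
    move=> xy /andP[ly yh]; have jn : h - y < n by rewrite /n; lia.
    have jn' : n - (h - y).+1 < n by lia.
    have [x1 _] : 0 < x /\ 0 < y by have [h1 _ _] := pE2; apply: h1 xy.
    have xc := bE2 _ _ xy.
    have [i _ /andP[_ wi]] : exists2 i, i < m E & vflip n (w0 E) i (h - y).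
      apply/(growth_rows pm2 pvw t2 jn); exists x.-1; first by lia.
      by rewrite /mat prednK // subKn.
    have [|i' i'c mi'] := (growth_rows pw pm w0c jn').1.
      by exists i => //; apply: (w0b _ _ wi).1.
    exists i'.+1; split=> //; move: mi'; rewrite /mat.
    by have -> : h - (n - (h - y).+1) = l + h - y by rewrite /n; lia.
  have rN x y : (x, y) \in N E T -> exists x' : nat, (x', l + h - y) \in E /\ c < x'.
    rewrite memN => /and5P[cx xw ly yh b]; have jn : y - l < n by rewrite /n; lia.
    have [|b' b'd /andP[b'w Hb]] := (growth_rows pn2 pH n2c jn).1.
      by exists (w - x) => //; rewrite /d; lia.
    exists (w - b'.+1).+1; split; last by move: b'd; rewrite /d; lia.
    by move: Hb; rewrite /mat; have -> : h - (y - l) = l + h - y by lia.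
  have pE3 : pfill E3.
    have [p1 p2 p3] := pE2; split=> [x y|x y y'|x x' y]; rewrite !in_fsetU.
    - by case/orP => [/p1|/memN'[]] //; lia.
    - case/orP => [e1|e1] /orP[e2|e2]; first exact: p2 e1 e2.
      + by have [? _ _ _] := memN' _ _ e2; have := bE2 _ _ e1; lia.
      + by have [? _ _ _] := memN' _ _ e1; have := bE2 _ _ e2; lia.
      + move: e1 e2; rewrite !memN => /and5P[_ _ ly _ b] /and5P[_ _ ly' _ b'].
        by have := pn2.2 _ _ _ b b'; lia.
    - have disj u v y' : (u, y') \in E2 -> (v, y') \in N E T -> False.
        move=> e1 e2; have [_ _ ly yh] := memN' _ _ e2.
        have [|u' [e1' uc]] := r2 _ _ e1; first by rewrite ly.
        have [v' [e2' cv]] := rN _ _ e2.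
        have [_ _ q3] := pE; have := q3 _ _ _ e1' e2'; lia.
      case/orP => [e1|e1] /orP[e2|e2]; first exact: p3 e1 e2.
      + by case: (disj _ _ _ e1 e2).
      + by case: (disj _ _ _ e2 e1).
      + move: e1 e2; rewrite !memN => /and5P[_ xw _ _ b] /and5P[_ xw' _ _ b'].
        by have := pn2.1 _ _ _ b b'; lia.
  have ES3 : {subset E3 <= S}.
    move=> [x y]; rewrite in_fsetU => /orP[/E2S //|/memN'[cx xw ly yh]].
    by rewrite rect2 // ly.
  have bE3 x y : (x, y) \in E3 -> x <= w /\ y <= h.
    rewrite in_fsetU => /orP[xy|/memN'[]//]; have xc := bE2 _ _ xy; split; first by lia.
    have [ly|] := leqP l y; last by lia.
    by have := E2S _ xy; rewrite rect1 // => /andP[].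
  have lE3 x y : (x, y) \in E3 -> c < x -> l <= y.
    by rewrite in_fsetU => /orP[/bE2|/memN'[]//]; lia.
  have rows3 y : 0 < y <= h -> exists x : nat, (x, y) \in E3.
    move=> /andP[y0 yh]; have [ly|yl] := leqP l y; last first.
      by have [|x xy] := rE2 y; [rewrite y0 | exists x; rewrite in_fsetU xy].
    have [|x xy] := rE (l + h - y); first by lia.
    have jn : y - l < n by rewrite /n; lia.
    have [x1 _] : 0 < x /\ 0 < l + h - y by have [h1 _ _] := pE; apply: h1 xy.
    have [xw _] := bE _ _ xy.
    have ey : h - (y - l) = l + h - y by lia.
    have [xc|cx] := leqP x c.
      have [|i im wi] := (growth_rows pw pm w0c jn).2.
        by exists x.-1; [lia | rewrite /mat prednK // ey].
      have jn' : n - (y - l).+1 < n by lia.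
      have [|i' _ mi'] := (growth_rows pm2 pvw t2 jn').2.
        exists i => //; rewrite /vflip jn' /=.
        by have -> : n - (n - (y - l).+1).+1 = y - l by lia.
      exists i'.+1; rewrite in_fsetU; apply/orP; left; move: mi'; rewrite /mat.
      by have -> : h - (n - (y - l).+1) = y by rewrite /n; lia.
    have [|b bd nb] := (growth_rows pn2 pH n2c jn).2.
      exists (w - x); first by rewrite /d; lia.
      rewrite /hflip /mat ey; have -> : (w - (w - x).+1).+1 = x by lia.
      by rewrite xy andbT; lia.
    exists (w - b); rewrite in_fsetU memN; apply/orP; right.
    have -> : w - (w - b) = b by move: bd; rewrite /d; lia.
    by rewrite nb ly yh; move: bd; rewrite /d; lia.
  (* The half-turn of [E3] keeps the shape and puts the right part first, where [n2] can be
     exchanged for [H E]. Undoing only the horizontal reflection transposes once and leaves [g], the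
     old right part next to the vertically reflected [E2]. Reflecting vertically, exchanging [E2]
     for the reflected [w0] and reflecting back gives [z], in which [w0] is exchanged for the left
     part of [E]. *)
  have shape3 : growth (mat E3 h) w n = tr (growth (mat E h) w n).
    have ps := pperm_shift c pm.
    pose z := glue (m E) (w0 E) (shift c (mat E h)).
    pose g := glue c (vflip n (mat E2 h)) (shift c (mat E h)).
    have pz : pperm z.
      apply: pperm_glue => // i i' j im wi; apply/negP => mi'.
      have [|i1 i1c mi1] := (growth_rows pw pm w0c (w0b _ _ wi).2).1; first by exists i.
      by have := pm.1 _ _ _ mi1 mi'; lia.
    have pg : pperm g.
      apply: pperm_glue => [|//|i i' j ic /andP[jn mi]]; first exact: pperm_vflip.
      apply/negP => mi'; have [|x' [x'E x'c]] := r2 _ _ mi; first by move: jn; rewrite /n; lia.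
      have e1 : l + h - (h - (n - j.+1)) = h - j by move: jn; rewrite /n; lia.
      rewrite e1 in x'E; have [_ _ q3] := pE; have := q3 _ _ _ x'E mi'; lia.
    have pR3 : pperm (mat E3 h) by apply: pperm_mat.
    transitivity (growth (R E3) w n).
      by rewrite growth_vflip ?growth_hflip ?trK //; apply: pperm_hflip.
    transitivity (growth (hflip w g) w n).
      have sh0 j : j <= n -> growth (R E3) d j = growth (hflip w g) d j.
        move=> jn; rewrite g3 // n2c //.
        apply: (growth_ext (c := d) (n := j)) => // b j' bd _; rewrite /H /hflip /g /glue.
        have -> : (w - b.+1 < c) = false by move: bd; rewrite /d; lia.
        by rewrite /shift subnKC //; move: bd; rewrite /d; lia.
      have sh1 i j : i < c -> j < n -> R E3 (d + i) j = hflip w g (d + i) j.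
        move=> ic jn; rewrite /R /H /vflip /hflip /g /glue /vflip jn /=.
        have di : d + i < w by rewrite -ew addnC ltn_add2r.
        have dc : w - (d + i).+1 < c by rewrite /d; lia.
        rewrite di dc /= /mat in_fsetU orb_idr // => /memN'[]; lia.
      by have := growth_shift sh0 sh1 (leqnn c) (leqnn n); rewrite addnC ew.
    rewrite growth_hflip //; congr tr.
    rewrite -[LHS]trK -growth_vflip // -ew.
    transitivity (tr (growth (vflip n z) (m E + d) n)).
      congr tr; apply: growth_shift (leqnn d) (leqnn n).
        move=> j jn; transitivity (growth (mat E2 h) c j).
          apply: (growth_ext (c := c) (n := n)) => // i j' ic jn'.
          rewrite {1}/vflip /g /glue ic -[RHS](vflipK (mat E2 h) i jn').
          by rewrite [in RHS]/vflip jn'.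
        rewrite t2 //; apply: (growth_ext (c := m E) (n := n)) => // i j' im jn'.
        by rewrite /vflip /z /glue im.
      move=> i j id jn; rewrite /vflip jn /= /g /z /glue.
      have -> : (c + i < c) = false by lia.
      have -> : (m E + i < m E) = false by lia.
      by rewrite !addKn.
    rewrite growth_vflip // trK; apply: growth_shift (leqnn d) (leqnn n).
      move=> j jn; rewrite -w0c //.
      by apply: (growth_ext (c := m E) (n := n)) => // i j' im jn'; rewrite /z /glue im.
    move=> i j id jn; rewrite /z /glue.
    have -> : (m E + i < m E) = false by lia.
    by rewrite addKn.
  have gT j : j <= d -> growth (mat (tr E3) w) h j = nth fset0 T j.
    move=> jd; rewrite (growth_turn (c := c) (l := l)) ?l0 // -/n -/(H E3) -/(R E3).
    by rewrite g3 // n2r.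
  split=> //.
  - split; last by apply/row_tableauP; rewrite ed.
    split.
    + by move=> [x y]; rewrite !mem_tr => /ES3.
    + exact: pfill_tr.
    + split=> [x y|x xh]; first by rewrite mem_tr => /bE3[].
      by have [x' x'y] := rows3 x xh; exists x'; rewrite mem_tr.
    + move=> y /andP[y0 yc]; have [|x xy] := cE2 y; first by rewrite y0.
      by exists x; rewrite mem_tr in_fsetU xy.
    + move/has_pat_tr/(has_pat_split _ _ pE3 lh' bE3 colS (crossS _ ES3 bE3)).
      rewrite rE3 => -[//|]; rewrite en shape3 okshape_tr => nok.
      have [_ _ _ _] := stX; rewrite eXE; apply; apply/has_pat_tr.
      by apply/(has_pat_split _ _ pE lh' bE colS (crossS _ ES bE)); right.
  - by move=> j jn; rewrite g3 // n2c.
move=> X T stX; rewrite ed => sT cT eT.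
have [[st2 tab2 iF] rE3 [st3 tab3] g3 [w0r [pw w0c]]] := main X T stX sT cT eT.
split=> // X' stX' /row_tableau_eq; rewrite ed => tX eO.
have eT' : nth fset0 T d = tr (growth (mat X' w) h d) by rewrite eT tX.
have [[st2' tab2' _] rE3' _ g3' [w0r' [pw' w0c']]] := main X' T stX' sT cT eT'.
have {}eO := can_inj trK eO.
have [[pE ES] stE1 bE lE rE] := stE X stX.
have [[pE' ES'] stE1' bE' lE' rE'] := stE X' stX'.
have pm := pperm_mat h pE; have pm' := pperm_mat h pE'.
have eF : F (restrict c (tr X')) (T0 (tr X')) = F (restrict c (tr X)) (T0 (tr X)).
  by rewrite -rE3 -rE3' eO.
have eT0 : T0 (tr X') = T0 (tr X) by rewrite -tab2 -tab2' eF.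
have gT0 j : j <= n -> growth (vflip n (w0 (tr X'))) (m (tr X')) j =
    growth (vflip n (w0 (tr X))) (m (tr X)) j.
  by move=> jn; move/(congr1 (fun T => nth fset0 T j)): eT0; rewrite !nth_mkseq.
have eA : A0 (tr X') = A0 (tr X).
  have := gT0 n (leqnn n); rewrite !growth_vflip // w0c // w0c' //.
  exact: (can_inj trK).
have em : m (tr X') = m (tr X) by rewrite /m eA.
(* Both borders of the reflected stand-ins agree: one is [T0], known from the image, the other is
   the transposed chain selected for the common shape. *)
have ewf := @growth_uniq (vflip n (w0 (tr X'))) (vflip n (w0 (tr X))) (m (tr X)) n
  (pperm_vflip n pw') (pperm_vflip n pw).
have {}ewf i j : i < m (tr X) -> j < n -> w0 (tr X') i j = w0 (tr X) i j.
  move=> im jn; rewrite -[LHS](vflipK _ i jn) -[RHS](vflipK _ i jn) {1}/vflip [RHS]/vflip.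
  rewrite jn /=; apply: ewf => //; [|by move=> i' i'm; rewrite !growth_vflip // w0r // w0r' ?em // eA | lia].
  by move=> j' jn'; rewrite -{1}em gT0.
have gE j : j <= n -> growth (mat (tr X') h) c j = growth (mat (tr X) h) c j.
  move=> jn; rewrite -w0c // -w0c' // em.
  by apply: (growth_ext (c := m (tr X)) (n := n)).
have eR : restrict c (tr X') = restrict c (tr X).
  apply: iF => //; last by rewrite -{1}eT0.
  by apply/row_tableau_eq => j jn; rewrite !growth_restrict // gE.
(* The right parts agree on one border because the image retains it, and on the other because
   [growth_turn] identifies it with the row tableau, which is common by hypothesis. *)
have eH := growth_uniq (pperm_hflip w pm') (pperm_hflip w pm).
have {}eH b j : b < d -> j < n -> H (tr X') b j = H (tr X) b j.
  apply: eH => [j' jn'|b' bd]; first by rewrite -(g3 j' jn') -(g3' j' jn') eO.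
  apply: (can_inj trK); rewrite -!growth_vflip //; try exact: pperm_hflip.
  rewrite -!(growth_turn (c := c) (l := l)) ?l0 // !trK.
  exact: tX.
apply: (can_inj trK); apply/fsetP => -[x y]; have [xc|cx] := leqP x c.
  by move/fsetP/(_ (x, y)): eR; rewrite !mem_restrict xc !andbT.
have memH X0 : state a k (tr S) h c.+1 X0 -> ((x, y) \in tr X0) =
    [&& x <= w, l <= y, y <= h & H (tr X0) (w - x) (h - y)].
  move=> /stE[_ _ bE0 lE0 _].
  have HE : x <= w -> y <= h -> H (tr X0) (w - x) (h - y) = ((x, y) \in tr X0).
    move=> xw yh; rewrite /H /hflip /mat subKn //.
    have -> : (w - (w - x).+1).+1 = x by lia.
    by have -> : w - x < w by lia.
  apply/idP/and4P => [xy|[xw ly yh]]; last by rewrite HE.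
  by have [xw yh] := bE0 _ _ xy; split=> //; [apply: lE0 xy cx | rewrite HE].
rewrite !memH //; case xw : (x <= w) => //=; case ly : (l <= y) => //=.
case yh : (y <= h) => //=; apply: eH; rewrite /d /n; lia.
Qed.

(** * D-free skew shapes *)

(* Without empty rows and columns: otherwise no transversal filling exists. *)
Definition skew_geometry (S : {fset nat * nat}) (W H : nat) : Prop :=
  [/\ forall x y : nat, (x, y) \in S -> 0 < x <= W /\ 0 < y <= H,
      forall x y x' y' u v : nat, (x, y) \in S -> (x', y') \in S ->
        x <= u <= x' -> y' <= v <= y -> (u, v) \in S,
      forall x1 x2 x3 y1 y2 y3 : nat, x1 < x2 < x3 -> y1 < y2 < y3 ->
        (x1, y3) \notin S -> (x3, y1) \notin S ->
        {subset [:: (x1, y1); (x1, y2); (x2, y1); (x2, y2); (x2, y3); (x3, y2); (x3, y3)] <= S} ->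
        False,
      forall x : nat, 0 < x <= W -> exists y : nat, (x, y) \in S
    & forall y : nat, 0 < y <= H -> exists x : nat, (x, y) \in S].

Lemma skew_geometry_tr S W H : skew_geometry S W H -> skew_geometry (tr S) H W.
Proof.
case=> [bS sk dS cS rS]; split.
- by move=> x y; rewrite mem_tr => /bS[].
- by move=> x y x' y' u v; rewrite !mem_tr => h1 h2 ? ?; apply: sk h2 h1 _ _.
- move=> x1 x2 x3 y1 y2 y3 hx hy; rewrite !mem_tr => n1 n2 al.
  apply: (dS y1 y2 y3 x1 x2 x3) => // -[x y] xy.
  have := al (y, x); rewrite mem_tr; apply; move: xy.
  rewrite !inE !xpair_eqE; do !case: (_ == _); by rewrite ?orbT.
- by move=> x /rS[y]; exists y; rewrite mem_tr.
- by move=> y /cS[x]; exists x; rewrite mem_tr.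
Qed.

Lemma state_tr a k S W H E : skew_geometry S W H ->
  state a k (tr S) H W.+1 (tr E) <-> state a k S W H.+1 E.
Proof.
suff T S' W' H' E' : skew_geometry S' W' H' -> state a k S' W' H'.+1 E' ->
    state a k (tr S') H' W'.+1 (tr E').
  move=> g; split; last exact: T.
  by move=> /(T _ _ _ _ (skew_geometry_tr g)); rewrite !trK.
move=> [bS _ _ _ _] [ES pE [bE cE] rE nE]; split.
- by move=> [x y]; rewrite !mem_tr => /ES.
- exact: pfill_tr.
- split=> [x y|x]; first by rewrite mem_tr => /ES/bS[_ /andP[]].
  by move=> /rE[y yx]; exists y; rewrite mem_tr.
- by move=> y /cE[x xy]; exists x; rewrite mem_tr.
- by move/has_pat_tr.
Qed.

Definition full_injection a k S W H : Prop :=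
  exists G : {fset nat * nat} -> {fset nat * nat}, forall E, state a k S W H.+1 E ->
    state (~~ a) k S W H.+1 (G E) /\
    forall E', state a k S W H.+1 E' -> G E' = G E -> E' = E.

Lemma transfer_init a k S : (forall x y : nat, (x, y) \in S -> 0 < x /\ 0 < y) ->
  transferable a k S 0 1 0.
Proof.
move=> pS; have E0 E : state a k S 0 1 E -> E = fset0.
  case=> ES _ [bE _] _ _; apply/fsetP => -[x y]; rewrite inE; apply/negP => xy.
  by have := bE _ _ xy; have [] := pS _ _ (ES _ xy); lia.
exists (fun _ _ => fset0) => E T stE sT cT eT; split.
- split=> //; try by split.
  + split=> [x y|x]; [by rewrite inE | lia].
  + by move=> y; lia.
  + by case=> -[|p s] [//= _ _ /(_ p (mem_head _ _))].
- apply/row_tableauP => // -[|//] _; by rewrite cT.1.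
- by move=> E' /E0 -> _ _; rewrite (E0 _ stE).
Qed.

Lemma max_exists (P : nat -> Prop) b m : P m -> (forall i, P i -> i <= b) ->
  exists2 i, P i & forall j, P j -> j <= i.
Proof.
move=> Pm bP; have ex : exists i, boolp.asbool (P i) by exists m; apply/boolp.asboolP.
have bP' i : boolp.asbool (P i) -> i <= b by move=> /boolp.asboolP/bP.
case: (ex_maxnP ex bP') => i /boolp.asboolP Pi mi; exists i => // j Pj.
by apply: mi; apply/boolp.asboolP.
Qed.

(** Throughout, the filled columns meet the active rows in the rectangle of columns [x0..c] and rows
    [l..h]. Row [l] is dropped if it ends by column [c]; otherwise column [c.+1] is added if it does
    not rise above a nonempty rectangle. If it does, the shape is transposed and [(c, l, h)] becomes
    [(h, c.+1, w)]; the measure still decreases since [l <= h]. *)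
Lemma transfer_full a k m : forall S W H c l x0 h, skew_geometry S W H ->
  (W - c) + (H.+1 - l) < m -> c <= W -> 0 < l <= H.+1 -> 0 < x0 ->
  (forall x y : nat, x <= c -> l <= y -> ((x, y) \in S) = (x0 <= x) && (y <= h)) ->
  (forall x y : nat, (x, y) \in S -> y < l -> x <= c) ->
  transferable a k S c l h -> full_injection a k S W H.
Proof.
elim: m => [//|m IH] S W H c l x0 h geo hm cW /andP[l0 lH] x00 rect dn nc.
have [bS sk dS cS rS] := geo.
have pS (x y : nat) : (x, y) \in S -> 0 < x /\ 0 < y by move=> /bS; lia.
have [lH'|Hl] := leqP l H; last first.
  have el : l = H.+1 by lia.
  have ec : c = W.
    apply/eqP; rewrite eqn_leq cW leqNgt; apply/negP => cW'.
    have [|y xy] := cS c.+1; first by lia.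
    by have := dn _ _ xy; have [_] := bS _ _ xy; lia.
  subst l c; case: nc => F HF.
  have g0 b E : state b k S W H.+1 E -> forall j, j <= h.+1 - H.+1 ->
      growth (mat E h) W j = fset0.
    case=> ES _ _ _ _ j jn; apply: (growth_empty (c := W) (n := h.+1 - H.+1)) => // i j' _ jn'.
    by apply/negP => /ES/bS[_]; lia.
  (* No row of the shape is active any more, so every tableau consists of empty diagrams, and
     injectivity among fillings with the same tableau is plain injectivity. *)
  pose T0 : seq diagram := nseq (h.+1 - H.+1).+1 fset0.
  have nT0 j : nth fset0 T0 j = fset0 by rewrite nth_nseq if_same.
  exists (fun E => F E T0) => E stE.
  have [|||st2 _ iF] := HF E T0 stE.
  - by rewrite size_nseq.
  - by split=> [|j _]; rewrite !nT0 //; apply: step_refl.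
  - by rewrite nT0 (g0 a) // tr0.
  split=> // E' stE' eF; apply: iF => //; apply/row_tableau_eq => j jn.
  by rewrite !(g0 a).
have [[x1 [x1l cx1]]|nx] := boolp.EM (exists x, (x, l) \in S /\ c < x); last first.
  have dl (x : nat) : (x, l) \in S -> x <= c.
    by move=> xl; rewrite leqNgt; apply/negP => cx; apply: nx; exists x.
  have [|x xl] := rS l; first by rewrite l0.
  have lh : l <= h by have := xl; rewrite rect ?dl // => /andP[].
  apply: (IH S W H c l.+1 x0 h) => //; try lia.
  - by move=> x' y xc ly; apply: rect => //; lia.
  - move=> x' y xy yl; have [|ly] := leqP y.+1 l; first exact: dn.
    have ey : y = l by lia.
    by subst y; apply: dl.
  - by apply: transfer_drop_row => //; rewrite l0.
have cW' : c < W by have [] := bS _ _ x1l; lia.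
have [|y0 cy0] := cS c.+1; first lia.
have colP (x y : nat) : (x, y) \in S -> c < x -> l <= y.
  by move=> xy cx; rewrite leqNgt; apply/negP => /(dn _ _ xy); lia.
have cl : (c.+1, l) \in S.
  by apply: (sk _ _ _ _ _ _ cy0 x1l); rewrite ?leqnn ?cx1 // (colP _ _ cy0).
have [|h' ch' mh'] := @max_exists (fun y => (c.+1, y) \in S) H l cl.
  by move=> y /bS[_ /andP[]].
have col1 y : ((c.+1, y) \in S) = (l <= y) && (y <= h').
  apply/idP/andP => [cy|[ly yh]]; first by rewrite (colP _ _ cy) // mh'.
  by apply: (sk _ _ _ _ _ _ ch' cl); rewrite ?leqnn ?ly.
have lh' : l <= h' by apply: mh'.
have step x0' h1 : h1 = h' -> 0 < x0' <= c.+1 ->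
    (forall x y : nat, x <= c -> l <= y -> ((x, y) \in S) = (x0' <= x) && (y <= h1)) ->
    transferable a k S c l h1 -> full_injection a k S W H.
  move=> -> /andP[x0'0 x0'c] rect' nc'.
  have rect2 (x y : nat) : x <= c.+1 -> l <= y -> ((x, y) \in S) = (x0' <= x) && (y <= h').
    rewrite leq_eqVlt ltnS => /orP[/eqP->|xc] ly; last exact: rect'.
    by rewrite col1 ly x0'c.
  apply: (IH S W H c.+1 l x0' h') => //; try lia.
    by move=> x y xy yl; apply: leqW; apply: dn xy yl.
  by apply: (transfer_add_column (x0 := x0')) => //; rewrite l0.
(* If the current rectangle is empty, a new one starts with column [c.+1]. *)
have [/andP[x0c lh]|emp] := boolP ((x0 <= c) && (l <= h)); last first.
  have em (x y : nat) : x <= c -> l <= y -> (x, y) \notin S.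
    by move=> xc ly; rewrite rect //; lia.
  apply: (step c.+1 h') => //; first by rewrite leqnn.
    by move=> x y xc ly; rewrite (negbTE (em x y xc ly)); lia.
  exact: transfer_empty nc.
have ch : (c, h) \in S by rewrite rect // x0c leqnn.
have hh' : h <= h'.
  by apply: mh'; apply: (sk _ _ _ _ _ _ ch cl); rewrite ?leqnn ?leqnSn ?lh.
have [eh|nh] := eqVneq h h'; first by apply: (step x0 h) => //; lia.
have [|w wl mw] := @max_exists (fun x => (x, l) \in S) W x1 x1l.
  by move=> x /bS[/andP[]].
have x1w : x1 <= w by apply: mw.
have wW : w <= W by have [/andP[]] := bS _ _ wl.
have rect2 (x y : nat) : c < x -> y <= h -> ((x, y) \in S) = (l <= y) && (x <= w).
  move=> cx yh; apply/idP/andP => [xy|[ly xw]]; last first.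
    by apply: (sk _ _ _ _ _ _ ch wl); rewrite ?ly ?yh ?xw ?(ltnW cx).
  have ly := colP _ _ xy cx; split=> //; rewrite leqNgt; apply/negP => wx.
  have yl : l < y.
    rewrite ltn_neqAle ly andbT; apply/eqP => el; subst y.
    by have := mw _ xy; lia.
  have ox : c < c.+1 < x by lia.
  have oy : l < y < h.+1 by lia.
  have nch : (c, h.+1) \notin S by rewrite rect ?ltnn ?andbF // (leq_trans lh).
  (* D-freeness: all active rows end in the same column. *)
  have nxl : (x, l) \notin S.
    by apply/negP => xl; have := mw _ xl; rewrite leqNgt wx.
  (* Columns [c], [c.+1], [x] and rows [l], [y], [h.+1] form the forbidden occurrence, with missing
     corners [(c, h.+1)] and [(x, l)]. *)
  apply: (dS _ _ _ _ _ _ ox oy nch nxl).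
  have lhh : l <= h.+1 <= h' by rewrite leqW //= ltn_neqAle nh.
  have c1h : (c.+1, h.+1) \in S by rewrite col1.
  have cxx : c.+1 <= x <= x by rewrite leqnn andbT.
  have lyh : l <= y <= h' by rewrite ly (leq_trans yh).
  move=> [u v]; rewrite !inE !xpair_eqE.
  case/or4P => [/andP[/eqP-> /eqP->]|/andP[/eqP-> /eqP->]|/andP[/eqP-> /eqP->]|] //.
  - by rewrite rect // x0c.
  - by rewrite rect // x0c.
  case/or4P => [/andP[/eqP-> /eqP->]|/andP[/eqP-> /eqP->]|/andP[/eqP-> /eqP->]|/andP[/eqP-> /eqP->]] //.
  - by rewrite col1.
  - by apply: (sk _ _ _ _ _ _ c1h xy cxx); rewrite leqnn leqW.
have nt : transferable a k (tr S) h c.+1 w.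
  by apply: (transfer_turn (x0 := x0) (l := l)) => //; lia.
have hH : h <= H by have [_ /andP[]] := bS _ _ ch.
have [||||||G HG] := IH (tr S) H W h c.+1 l w (skew_geometry_tr geo) _ _ _ _ _ _ nt; try lia.
- by move=> x y xh cy; rewrite mem_tr rect2.
- move=> x y; rewrite mem_tr ltnS => yx yc; have [lx|] := leqP l x; last lia.
  by move: yx; rewrite rect // => /andP[].
exists (fun E => tr (G (tr E))) => E /(state_tr _ _ _ geo) stE.
have [st2 iG] := HG _ stE; split.
  by apply/(state_tr _ _ _ geo); rewrite trK.
move=> E' /(state_tr _ _ _ geo) stE' /(can_inj trK) eG.
by apply: (can_inj trK); apply: iG.
Qed.

Lemma full_injection_exists a k S W H : skew_geometry S W H -> full_injection a k S W H.
Proof.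
move=> geo; have [bS _ _ _ _] := geo.
have pS (x y : nat) : (x, y) \in S -> 0 < x /\ 0 < y by move=> /bS; lia.
apply: (transfer_full (m := (W - 0 + H).+1) (c := 0) (l := 1) (x0 := 1) (h := 0)) => //.
- by rewrite subn1.
- by move=> x y; case: x => // _ _; apply/negP => /bS[]; lia.
- by move=> x y /bS[_]; lia.
- exact: transfer_init.
Qed.

(** * Counting transversal fillings *)

Lemma le_width (S : cell_shape) (x y : nat) : (x, y) \in S -> x <= width S.
Proof. by move=> xy; apply: (@leq_bigmax_seq _ _ _ (fun p : cell => p.1) (x, y)). Qed.

Lemma le_height (S : cell_shape) (x y : nat) : (x, y) \in S -> y <= height S.
Proof. by move=> xy; apply: (@leq_bigmax_seq _ _ _ (fun p : cell => p.2) (x, y)). Qed.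

Lemma mem_square k (i j : nat) :
  ((i, j) \in square k) = (0 < i <= k) && (0 < j <= k).
Proof.
apply/imfset2P/idP => [[i' /=]|/andP[hi hj]].
  rewrite mem_iota => hi [j']; rewrite /= mem_iota => hj [-> ->]; lia.
by exists i; [|exists j]; rewrite //= mem_iota; lia.
Qed.

Lemma width_eq (S : cell_shape) k : (forall x y : nat, (x, y) \in S -> x <= k) ->
  (exists y : nat, (k, y) \in S) -> width S = k.
Proof.
move=> h [y ky]; apply/eqP; rewrite eqn_leq (le_width ky) andbT.
by apply/bigmax_leqP_seq => -[u v] uv _; apply: h uv.
Qed.

Lemma height_eq (S : cell_shape) k : (forall x y : nat, (x, y) \in S -> y <= k) ->
  (exists x : nat, (x, k) \in S) -> height S = k.
Proof.
move=> h [x xk]; apply/eqP; rewrite eqn_leq (le_height xk) andbT.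
by apply/bigmax_leqP_seq => -[u v] uv _; apply: h uv.
Qed.

Lemma width_square k : 0 < k -> width (square k) = k.
Proof.
move=> k0; apply: width_eq => [x y|]; first by rewrite mem_square; lia.
by exists k; rewrite mem_square; lia.
Qed.

Lemma height_square k : 0 < k -> height (square k) = k.
Proof.
move=> k0; apply: height_eq => [x y|]; first by rewrite mem_square; lia.
by exists k; rewrite mem_square; lia.
Qed.

Lemma one_cell_val (S : cell_shape) (phi : filling S) (u : S) : one_cell phi (val u) = phi u.
Proof. by rewrite /one_cell valK. Qed.

Lemma one_cell_in (S : cell_shape) (phi : filling S) p : one_cell phi p -> p \in S.
Proof. by rewrite /one_cell; case: insubP. Qed.

Definition ones (S : cell_shape) (phi : filling S) : cell_shape :=
  [fset p in S | one_cell phi p].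

Definition filling_of (S : cell_shape) (E : cell_shape) : filling S :=
  [ffun u => val u \in E].

Lemma mem_ones (S : cell_shape) (phi : filling S) p : (p \in ones phi) = one_cell phi p.
Proof. by rewrite !inE andb_idl // => /one_cell_in. Qed.

Lemma ones_filling_of (S E : cell_shape) : {subset E <= S} -> ones (filling_of S E) = E.
Proof.
move=> ES; apply/fsetP => p; rewrite mem_ones; apply/idP/idP => [h|pE].
  by have pS := one_cell_in h; move: h; rewrite -[p]/(val (FSetSub pS)) one_cell_val ffunE.
by rewrite -[p]/(val (FSetSub (ES _ pE))) one_cell_val ffunE.
Qed.

Lemma filling_of_ones (S : cell_shape) (phi : filling S) : filling_of S (ones phi) = phi.
Proof. by apply/ffunP => u; rewrite ffunE mem_ones one_cell_val. Qed.

Lemma transversalP (S : cell_shape) (phi : filling S) :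
  (forall x y : nat, (x, y) \in S -> 0 < x /\ 0 < y) ->
  Defs.transversal phi <->
  [/\ pfill (ones phi),
      forall x : nat, 0 < x <= width S -> exists y : nat, (x, y) \in ones phi
    & forall y : nat, 0 < y <= height S -> exists x : nat, (x, y) \in ones phi].
Proof.
move=> pS; split.
  case/andP => /forallP hr /forallP hc; split.
  - split=> [x y|x y y'|x x' y]; rewrite !mem_ones; first by move/one_cell_in/pS.
      move=> h1 h2; have s1 := one_cell_in h1; have s2 := one_cell_in h2.
      have [x0 _] := pS _ _ s1; have xw := le_width s1.
      have lt : x.-1 < width S by rewrite prednK.
      have /cards1P[z /setP hz] := hc (Ordinal lt).
      have := hz (FSetSub s1); have := hz (FSetSub s2).
      rewrite !inE -!one_cell_val /= h1 h2 prednK // eqxx => /esym/eqP e1 /esym/eqP e2.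
      by have := congr1 val (etrans e1 (esym e2)) => -[].
    move=> h1 h2; have s1 := one_cell_in h1; have s2 := one_cell_in h2.
    have [_ y0] := pS _ _ s1; have yh := le_height s1.
    have lt : y.-1 < height S by rewrite prednK.
    have /cards1P[z /setP hz] := hr (Ordinal lt).
    have := hz (FSetSub s1); have := hz (FSetSub s2).
    rewrite !inE -!one_cell_val /= h1 h2 prednK // eqxx => /esym/eqP e1 /esym/eqP e2.
    by have := congr1 val (etrans e1 (esym e2)) => -[].
  - move=> x /andP[x0 xw]; have lt : x.-1 < width S by rewrite prednK.
    have /cards1P[z /setP/(_ z)] := hc (Ordinal lt).
    rewrite !inE eqxx prednK // => /andP[pz /eqP <-].
    by exists (val z).2; rewrite mem_ones -surjective_pairing one_cell_val.
  - move=> y /andP[y0 yh]; have lt : y.-1 < height S by rewrite prednK.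
    have /cards1P[z /setP/(_ z)] := hr (Ordinal lt).
    rewrite !inE eqxx prednK // => /andP[pz /eqP <-].
    by exists (val z).1; rewrite mem_ones -surjective_pairing one_cell_val.
case=> -[_ p2 p3] hc hr; apply/andP; split; apply/forallP => i.
  have [|x xi] := hr i.+1; first by rewrite /= ltn_ord.
  have xi' := xi; rewrite mem_ones in xi; have s := one_cell_in xi.
  apply/cards1P; exists (FSetSub s); apply/setP => u; rewrite !inE.
  apply/andP/eqP => [[pu /eqP ui]|->]; last by rewrite -one_cell_val /= xi.
  apply: val_inj; rewrite /= [val u]surjective_pairing ui; congr (_, _).
  by apply: p3 xi'; rewrite mem_ones -ui -surjective_pairing one_cell_val.
have [|y iy] := hc i.+1; first by rewrite /= ltn_ord.
have iy' := iy; rewrite mem_ones in iy; have s := one_cell_in iy.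
apply/cards1P; exists (FSetSub s); apply/setP => u; rewrite !inE.
apply/andP/eqP => [[pu /eqP ui]|->]; last by rewrite -one_cell_val /= iy.
apply: val_inj; rewrite /= [val u]surjective_pairing ui; congr (_, _).
by apply: p2 iy'; rewrite mem_ones -ui -surjective_pairing one_cell_val.
Qed.

Definition diagonal (a : bool) (k : nat) : filling (square k) :=
  if a then iota_fill k else delta_fill k.

Lemma one_cell_diagonal a k i j : i < k -> j < k ->
  one_cell (diagonal a k) (i.+1, j.+1) = (j == if a then i else k - i.+1).
Proof.
move=> ik jk; have s : (i.+1, j.+1) \in square k by rewrite mem_square; lia.
rewrite -[(i.+1, j.+1)]/(val (FSetSub s)) one_cell_val /diagonal.
by case: a; rewrite ffunE /=; lia.
Qed.

Lemma increasingP m n (f : 'I_m -> 'I_n) : increasing f -> forall i j : 'I_m, i < j -> f i < f j.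
Proof. by move=> /forallP h i j ij; have /forallP/(_ j) := h i; rewrite ij. Qed.

Lemma fill_containsP (S : cell_shape) (phi : filling S) a k :
  (forall x y : nat, (x, y) \in S -> 0 < x /\ 0 < y) ->
  fill_contains phi (diagonal a k.+1) <-> has_pat a k.+1 S (ones phi).
Proof.
move=> pS; have wk := width_square (ltn0Sn k); have hk := height_square (ltn0Sn k).
have wlt (i : 'I_(width (square k.+1))) : i < k.+1.
  by apply: leq_trans (ltn_ord i) _; rewrite wk.
have hlt (j : 'I_(height (square k.+1))) : j < k.+1.
  by apply: leq_trans (ltn_ord j) _; rewrite hk.
(* The row of the 1 in column [j], both counted from 0. It is an involution on [0..k], so it also
   gives the column of the 1 in row [j]. *)
pose r0 j := if a then j else k - j.
split.
  case/existsP => c /existsP[r /andP[/and3P[ic ir /forallP occ] /forallP fil]].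
  pose cc i := if insub i is Some o then (c o).+1 else 0.
  pose rr j := if insub j is Some o then (r o).+1 else 0.
  have ccE i (ik : i < width (square k.+1)) : cc i = (c (Ordinal ik)).+1 by rewrite /cc insubT.
  have rrE j (jk : j < height (square k.+1)) : rr j = (r (Ordinal jk)).+1 by rewrite /rr insubT.
  have cc_lt i i' : i < i' -> i' < k.+1 -> cc i < cc i'.
    move=> ii ik; have h1 : i < width (square k.+1) by rewrite wk; lia.
    have h2 : i' < width (square k.+1) by rewrite wk.
    by rewrite !ccE ltnS; apply: increasingP.
  have rr_lt i i' : i < i' -> i' < k.+1 -> rr i < rr i'.
    move=> ii ik; have h1 : i < height (square k.+1) by rewrite hk; lia.
    have h2 : i' < height (square k.+1) by rewrite hk.
    by rewrite !rrE ltnS; apply: increasingP.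
  have occ' i j : i < k.+1 -> j < k.+1 -> (cc i, rr j) \in S.
    move=> ik jk; have h1 : i < width (square k.+1) by rewrite wk.
    have h2 : j < height (square k.+1) by rewrite hk.
    have /forallP/(_ (Ordinal h2))/eqP := occ (Ordinal h1).
    by rewrite ccE rrE => <-; rewrite mem_square /= ik jk.
  have fil' i j : i < k.+1 -> j < k.+1 -> j = r0 i -> one_cell phi (cc i, rr j).
    move=> ik jk ej; have h1 : i < width (square k.+1) by rewrite wk.
    have h2 : j < height (square k.+1) by rewrite hk.
    have /forallP/(_ (Ordinal h2))/implyP := fil (Ordinal h1).
    rewrite ccE rrE; apply; rewrite one_cell_diagonal //=; apply/eqP; rewrite ej /r0.
    by case: (a); rewrite ?subSS.
  exists [seq (cc i, rr (r0 i)) | i <- iota 0 k.+1].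
  have r0k i : i < k.+1 -> r0 i < k.+1 by rewrite /r0; case: (a); lia.
  rewrite size_map size_iota; split=> //.
  - rewrite sorted_map; apply: (sub_in_sorted (P := fun i => i < k.+1) _ _ (iota_ltn_sorted 0 k.+1)).
      move=> i j; rewrite !unfold_in /pat_lt /= => ik jk ij; rewrite cc_lt //=.
      by rewrite /r0; case: (a); apply: rr_lt; lia.
    by apply/allP => i; rewrite mem_iota.
  - move=> p /mapP[i]; rewrite mem_iota => /andP[_ ik] ->.
    by rewrite mem_ones; apply: fil' => //; apply: r0k.
  - move=> p q /mapP[i + ->] /mapP[j + ->]; rewrite !mem_iota => ik jk.
    by apply: occ' => //; apply: r0k.
case=> s [ss srt sE sS].
have sort_lt i j : i < j -> j < k.+1 -> pat_lt a (nth (0, 0) s i) (nth (0, 0) s j).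
  move=> ij jk; have tr_lt : transitive (pat_lt a).
    by move=> p q u; rewrite /pat_lt; case: (a); lia.
  by apply: (sorted_ltn_nth tr_lt (0, 0) srt) => //; rewrite inE ss; lia.
have nS i j : i < k.+1 -> j < k.+1 -> ((nth (0, 0) s i).1, (nth (0, 0) s j).2) \in S.
  by move=> ik jk; apply: sS; apply: mem_nth; rewrite ss.
have r0k i : i < k.+1 -> r0 i < k.+1 by rewrite /r0; case: (a); lia.
have cP (i : 'I_(width (square k.+1))) : (nth (0, 0) s i).1.-1 < width S.
  have ik : i < k.+1 by apply: wlt.
  have h := nS _ _ ik ik; have := le_width h; have [h0 _] := pS _ _ h.
  by rewrite -{1}(prednK h0).
have rP (j : 'I_(height (square k.+1))) : (nth (0, 0) s (r0 j)).2.-1 < height S.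
  have jk : r0 j < k.+1 by apply: r0k; apply: hlt.
  have h := nS _ _ jk jk; have := le_height h; have [_ h0] := pS _ _ h.
  by rewrite -{1}(prednK h0).
apply/existsP; exists [ffun i => Ordinal (cP i)].
apply/existsP; exists [ffun j => Ordinal (rP j)].
have cellE i j : cell_at ([ffun i => Ordinal (cP i)] i) ([ffun j => Ordinal (rP j)] j) =
    ((nth (0, 0) s i).1, (nth (0, 0) s (r0 j)).2).
  have ik : i < k.+1 by apply: wlt.
  have jk : r0 j < k.+1 by apply: r0k; apply: hlt.
  have [h1 h2] := pS _ _ (nS _ _ ik jk).
  by rewrite /cell_at !ffunE /= !prednK.
apply/andP; split; last first.
  apply/forallP => i; apply/forallP => j; apply/implyP.
  have ik : i < k.+1 by apply: wlt.
  have jk : j < k.+1 by apply: hlt.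
  rewrite /cell_at one_cell_diagonal // => /eqP ej; rewrite -/(cell_at _ _) cellE.
  have -> : r0 j = i by rewrite ej /r0; case: (a); lia.
  by rewrite -surjective_pairing -mem_ones sE // mem_nth // ss.
apply/and3P; split.
- apply/forallP => i; apply/forallP => j; apply/implyP => ij; rewrite !ffunE /=.
  have jk : j < k.+1 by apply: wlt.
  have ik : i < k.+1 by apply: wlt.
  have /andP[h1 _] := sort_lt _ _ ij jk.
  have [h2 _] := pS _ _ (nS _ _ ik ik); have [h3 _] := pS _ _ (nS _ _ jk jk); lia.
- apply/forallP => i; apply/forallP => j; apply/implyP => ij; rewrite !ffunE /=.
  have jk : j < k.+1 by apply: hlt.
  have ik : i < k.+1 by apply: hlt.
  have [_ h2] := pS _ _ (nS _ _ (r0k _ ik) (r0k _ ik)).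
  have [_ h3] := pS _ _ (nS _ _ (r0k _ jk) (r0k _ jk)).
  have : (nth (0, 0) s (r0 i)).2 < (nth (0, 0) s (r0 j)).2; last by lia.
  move: sort_lt; rewrite /r0 /pat_lt; case: (a) => h.
    by have /andP[_] := h _ _ ij jk.
  have ij' : k - j < k - i by lia.
  have ik' : k - i < k.+1 by lia.
  by have /andP[_] := h _ _ ij' ik'.
- apply/forallP => i; apply/forallP => j; apply/eqP; rewrite cellE.
  have ik : i < k.+1 by apply: wlt.
  have jk : j < k.+1 by apply: hlt.
  rewrite nS // ?r0k // mem_square; lia.
Qed.

Lemma NW_Ferrers_closed a b F (x y u v : nat) : NW_Ferrers a b F ->
  (x, y) \in F -> a <= u <= x -> y <= v <= b -> (u, v) \in F.
Proof.
case=> rc cc hl ht xy /andP[au ux] /andP[yv vb].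
have [xb _] := ht _ _ xy.
have xv : (x, v) \in F by apply: cc xy xb; rewrite yv.
by have [av _] := hl _ _ xv; apply: rc av xv; rewrite au.
Qed.

Lemma mem_translate s t S (x y : nat) : ((x + s, y + t) \in translate s t S) = ((x, y) \in S).
Proof.
apply/imfsetP/idP => [[[u v] /= uv [/addIn -> /addIn ->]] //|xy].
by exists (x, y).
Qed.

(** Ferrers shapes are closed towards their top-left corner: the lower right cell puts [(u, v)] into
    [F1], and the upper left cell keeps it out of [F2]. *)
Lemma skew_closed S (x y x' y' u v : nat) : skew_shape S -> (x, y) \in S -> (x', y') \in S ->
  x <= u <= x' -> y' <= v <= y -> (u, v) \in S.
Proof.
move=> [s [t [a [b [F1 [F2 [N1 N2 e]]]]]]].
rewrite -!(mem_translate s t S) e !in_fsetD => /andP[n2 h1] /andP[_ h1'] /andP[xu ux] /andP[yv vy].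
have [_ _ hl ht] := N1; have [_ ax] := hl _ _ h1; have [_ yb] := ht _ _ h1.
apply/andP; split; last by apply: (NW_Ferrers_closed N1 h1'); lia.
by apply: contra n2 => h2; apply: (NW_Ferrers_closed N2 h2); lia.
Qed.

Lemma mem_D_shape (i j : nat) : ((i, j) \in D_shape) =
  [&& 0 < i <= 3, 0 < j <= 3, ~~ ((i == 1) && (j == 3)) & ~~ ((i == 3) && (j == 1))].
Proof.
rewrite in_fsetD mem_square !inE !xpair_eqE negb_or.
by case: (0 < i <= 3); case: (0 < j <= 3); rewrite ?andbT ?andbF.
Qed.

Lemma width_D_shape : width D_shape = 3.
Proof.
apply: width_eq => [x y|]; first by rewrite mem_D_shape; lia.
by exists 3; rewrite mem_D_shape.
Qed.

Lemma height_D_shape : height D_shape = 3.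
Proof.
apply: height_eq => [x y|]; first by rewrite mem_D_shape; lia.
by exists 3; rewrite mem_D_shape.
Qed.

Lemma D_free_elim (S : cell_shape) (x1 x2 x3 y1 y2 y3 : nat) :
  (forall x y : nat, (x, y) \in S -> 0 < x /\ 0 < y) -> D_free S ->
  x1 < x2 < x3 -> y1 < y2 < y3 -> (x1, y3) \notin S -> (x3, y1) \notin S ->
  {subset [:: (x1, y1); (x1, y2); (x2, y1); (x2, y2); (x2, y3); (x3, y2); (x3, y3)] <= S} ->
  False.
Proof.
move=> pS /negP dS /andP[x12 x23] /andP[y12 y23] n13 n31 al; apply: dS.
have m11 : (x1, y1) \in S by apply: al; rewrite !inE eqxx ?orbT.
have m12 : (x1, y2) \in S by apply: al; rewrite !inE eqxx ?orbT.
have m21 : (x2, y1) \in S by apply: al; rewrite !inE eqxx ?orbT.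
have m22 : (x2, y2) \in S by apply: al; rewrite !inE eqxx ?orbT.
have m23 : (x2, y3) \in S by apply: al; rewrite !inE eqxx ?orbT.
have m32 : (x3, y2) \in S by apply: al; rewrite !inE eqxx ?orbT.
have m33 : (x3, y3) \in S by apply: al; rewrite !inE eqxx ?orbT.
have [x10 y10] := pS _ _ m11; have := le_width m33; have := le_height m33 => yh xw.
have [x20 x30] : 0 < x2 /\ 0 < x3 by split; [apply: leq_trans x12 | apply: leq_trans x23].
have [y20 y30] : 0 < y2 /\ 0 < y3 by split; [apply: leq_trans y12 | apply: leq_trans y23].
pose X i := nth 0 [:: x1; x2; x3] i; pose Y i := nth 0 [:: y1; y2; y3] i.
have XP (i : 'I_(width D_shape)) : (X i).-1 < width S.
  have : i < 3 by apply: leq_trans (ltn_ord i) _; rewrite width_D_shape.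
  by clear al n13 n31 m11 m12 m21 m22 m23 m32 m33 pS;
    rewrite /X; case: (nat_of_ord i) => [|[|[|]]] //= _; lia.
have YP (i : 'I_(height D_shape)) : (Y i).-1 < height S.
  have : i < 3 by apply: leq_trans (ltn_ord i) _; rewrite height_D_shape.
  by clear al n13 n31 m11 m12 m21 m22 m23 m32 m33 pS;
    rewrite /Y; case: (nat_of_ord i) => [|[|[|]]] //= _; lia.
apply/existsP; exists [ffun i => Ordinal (XP i)].
apply/existsP; exists [ffun i => Ordinal (YP i)].
apply/and3P; split.
- apply/forallP => i; apply/forallP => j; apply/implyP; rewrite !ffunE /=.
  have : j < 3 by apply: leq_trans (ltn_ord j) _; rewrite width_D_shape.
  clear al n13 n31 m11 m12 m21 m22 m23 m32 m33 pS.
  rewrite /X; case: (nat_of_ord j) => [|[|[|]]] //= _; case: (nat_of_ord i) => [|[|]] //= _; lia.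
- apply/forallP => i; apply/forallP => j; apply/implyP; rewrite !ffunE /=.
  have : j < 3 by apply: leq_trans (ltn_ord j) _; rewrite height_D_shape.
  clear al n13 n31 m11 m12 m21 m22 m23 m32 m33 pS.
  rewrite /Y; case: (nat_of_ord j) => [|[|[|]]] //= _; case: (nat_of_ord i) => [|[|]] //= _; lia.
- apply/forallP => i; apply/forallP => j; rewrite /cell_at !ffunE /= mem_D_shape.
  have : j < 3 by apply: leq_trans (ltn_ord j) _; rewrite height_D_shape.
  have : i < 3 by apply: leq_trans (ltn_ord i) _; rewrite width_D_shape.
  have e x : 0 < x -> x.-1.+1 = x by apply: prednK.
  rewrite /X /Y; case: (nat_of_ord i) => [|[|[|]]] //= _;
    case: (nat_of_ord j) => [|[|[|]]] //= _; rewrite !e ?m11 ?m12 ?m21 ?m22 ?m23 ?m32 ?m33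
    ?(negbTE n13) ?(negbTE n31) //.
Qed.

Lemma skew_geometry_of_shape (S : cell_shape) (phi : filling S) :
  placed S -> skew_shape S -> D_free S -> Defs.transversal phi ->
  skew_geometry S (width S) (height S).
Proof.
move=> [pS _] sS dS tphi.
have pS' (x y : nat) : (x, y) \in S -> 0 < x /\ 0 < y by move=> /pS.
have [_ hc hr] := (transversalP phi pS').1 tphi; split.
- by move=> x y xy; have [-> ->] := pS' _ _ xy; rewrite (le_width xy) (le_height xy).
- by move=> x y x' y' u v; apply: skew_closed.
- by move=> x1 x2 x3 y1 y2 y3; apply: D_free_elim.
- by move=> x /hc[y]; rewrite mem_ones => /one_cell_in; exists y.
- by move=> y /hr[x]; rewrite mem_ones => /one_cell_in; exists x.
Qed.

Lemma state_ones (S : cell_shape) (phi : filling S) a k :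
  (forall x y : nat, (x, y) \in S -> 0 < x /\ 0 < y) ->
  (Defs.transversal phi && ~~ fill_contains phi (diagonal a k.+1)) <->
  state a k S (width S) (height S).+1 (ones phi).
Proof.
move=> pS; have fc := fill_containsP phi a k pS; split.
  case/andP => /(transversalP phi pS)[h1 h2 h3] /negP nf; split=> //.
  - by move=> p; rewrite mem_ones => /one_cell_in.
  - by split=> // x y; rewrite mem_ones => /one_cell_in/le_width.
  - by move/fc.
case=> _ h1 [_ h2] h3 h4; apply/andP; split; first by apply/(transversalP phi pS).
by apply/negP => /fc.
Qed.

(** If there is no filling to count on the left, the bound is trivial. Otherwise one filling
    certifies that no row or column is empty, as [skew_geometry] requires, and the transfer is an
    injection. *)
Lemma Tr_diagonal_le (S : cell_shape) a k : placed S -> skew_shape S -> D_free S ->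
  Tr S (diagonal a k.+1) <= Tr S (diagonal (~~ a) k.+1).
Proof.
move=> plS sS dS; have pS (x y : nat) : (x, y) \in S -> 0 < x /\ 0 < y by move=> /plS.1.
rewrite /Tr; set A := [set phi | _]; set B := [set phi | _].
have [->|[phi0]] := set_0Vmem A; first by rewrite cards0.
rewrite inE => /andP[tphi _].
have [G HG] := full_injection_exists a k (skew_geometry_of_shape plS sS dS tphi).
pose f (phi : filling S) : filling S := filling_of S (G (ones phi)).
have fE phi : phi \in A -> ones (f phi) = G (ones phi).
  rewrite inE => /(state_ones _ _ _ pS)/HG[[GS _ _ _ _] _].
  exact: ones_filling_of.
rewrite -(@card_in_imset _ _ f A).
  apply: subset_leq_card; apply/subsetP => _ /imsetP[phi phiA ->].
  rewrite inE; apply/(state_ones _ _ _ pS); rewrite fE //.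
  by move: phiA; rewrite inE => /(state_ones _ _ _ pS)/HG[].
move=> phi psi phiA psiA ef; rewrite -[phi]filling_of_ones -[psi]filling_of_ones.
congr (filling_of _ _); have e : G (ones phi) = G (ones psi) by rewrite -!fE // ef.
move: phiA psiA; rewrite !inE => /(state_ones _ _ _ pS) h1 /(state_ones _ _ _ pS)/HG[_].
exact.
Qed.

Theorem corollary2p3 (S : cell_shape) (k : nat) :
  placed S -> skew_shape S -> D_free S -> 1 <= k ->
  Tr S (delta_fill k) = Tr S (iota_fill k).
Proof.
move=> plS sS dS; case: k => [|k _]; first discriminate.
apply/eqP; rewrite eqn_leq.
exact/andP/(conj (Tr_diagonal_le false k plS sS dS) (Tr_diagonal_le true k plS sS dS)).
Qed.
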